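(* For all $g\ge0$, $n\ge1$ with $2g-2+n>0$ and all positive integers $\mu_1,\dots,\mu_n$, $$ D_{g,n}(\mu_1,\dots,\mu_n)=\sum_{\ell_1>\frac{\mu_1}{2}}\cdots\sum_{\ell_n>\frac{\mu_n}{2}}\ \prod_{i=1}^n\frac{2\ell_i-\mu_i}{\mu_i}\binom{\mu_i}{\ell_i}\;N_{g,n}(2\ell_1-\mu_1,\dots,2\ell_n-\mu_n), $$ where the $\ell_i$ range over integers.
   Context: A Belyi morphism is a holomorphic map $b:C\to\mathbb{P}^1$ from a smooth connected projective complex curve $C$, branched only over $0,1,\infty$. It is clean if every point of $b^{-1}(1)$ has ramification index exactly $2$. $D_{g,n}(\mu_1,\dots,\mu_n)$ is the number of isomorphism classes of clean Belyi morphisms with $C$ of genus $g$ and exactly $n$ labeled poles of orders $\mu_1,\dots,\mu_n$, each counted with weight $1/|\mathrm{Aut}|$, where automorphisms commute with $b$ and fix every pole. Equivalently it is the weighted count of connected cellularly embedded graphs on a closed oriented genus $g$ surface with $n$ labeled vertices of degrees $\mu_1,\dots,\mu_n$ (automorphisms fix each vertex). A ribbon graph of type $(g,n)$ is the 1-skeleton of a cell-decomposition of a closed connected oriented surface of genus $g$ with $n$ two-cells (faces), equivalently a graph with a cyclic order on the half-edges at each vertex. Here faces are labeled by $1,\dots,n$, every vertex is required to have degree at least $3$, and $\mathrm{Aut}(\Gamma)$ is the group of ribbon graph automorphisms fixing each face. For a ribbon graph $\Gamma$ with edges labeled $1,\dots,e$, the edge-face incidence matrix is $A_\Gamma=[a_{i\eta}]_{1\le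 i\le n,1\le\eta\le e}$, where $a_{i\eta}\in\{0,1,2\}$ is the number of times edge $\eta$ appears in the boundary of face $i$. With $\mathbb{Z}_+$ the positive integers, for $2g-2+n>0$ and $\mu\in\mathbb{Z}_+^n$ define $$N_{g,n}(\mu)=\sum_{\Gamma\text{ ribbon graph of type }(g,n)}\frac{\big|\{\mathbf{x}\in\mathbb{Z}_+^{e}\mid A_\Gamma\mathbf{x}=\mu\}\big|}{|\mathrm{Aut}(\Gamma)|},$$ the sum being over isomorphism classes, $e=e(\Gamma)$. *)

(* Defs.v *)
From HB Require Import structures.
From mathcomp Require Import all_boot all_order all_algebra all_fingroup.
From mathcomp Require Import zify.

Set Implicit Arguments.
Unset Strict Implicit.
Unset Printing Implicit Defensive.

Import GRing.Theory.

(* A graph embedded in a closed oriented surface with all complementary       *)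
(* regions discs is encoded by its rotation system on the set D of half-edges:*)
(* vperm is the cyclic order around the vertices, eperm exchanges the two     *)
(* halves of an edge, and fperm walks along the boundary of the faces.        *)
(* Vertices, edges and faces are the cycles of these three permutations, so   *)
(* every vertex has positive degree. The labelling lab of the vertices (or of *)
(* the faces) by 1, ..., n is given on the half-edges they contain.           *)
Record lmap (D : finType) (n : nat) := LMap {
  vperm : {perm D};
  eperm : {perm D};
  lab : {ffun D -> 'I_n}
}.

Definition lmap_tuple D n (m : lmap D n) := (vperm m, eperm m, lab m).
Definition tuple_lmap D n (t : {perm D} * {perm D} * {ffun D -> 'I_n}) :=
  LMap t.1.1 t.1.2 t.2.
Lemma lmap_tupleK D n : cancel (@lmap_tuple D n) (@tuple_lmap D n).
Proof. by case. Qed.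
HB.instance Definition _ (D : finType) (n : nat) :=
  Finite.copy (lmap D n) (can_type (@lmap_tupleK D n)).

Section LabelledMaps.
Variables (D : finType) (n : nat).
Implicit Types m : lmap D n.

(* x |-> vperm (eperm x), as permutations compose from left to right. *)
Definition fperm m : {perm D} := (eperm m * vperm m)%g.

Definition edges m : {set {set D}} := porbits (eperm m).

Definition fixfree_involution (p : {perm D}) : bool :=
  [forall x, (p x != x) && (p (p x) == x)].

Definition connected_map m : bool :=
  [forall x, forall y,
    connect [rel u v | (v == vperm m u) || (v == eperm m u)] x y].

(* V - E + F = 2 - 2g *)
Definition has_genus (g : nat) m : bool :=
  #|porbits (vperm m)| + #|porbits (fperm m)| + 2 * g == #|edges m| + 2.

Definition embedded_graph (g : nat) m : bool :=
  [&& fixfree_involution (eperm m), connected_map m & has_genus g m].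

(* l induces a bijection from the cycles of p to {1, ..., n} *)
Definition labels_cycles (p : {perm D}) (l : {ffun D -> 'I_n}) : bool :=
  [forall x, forall y, (l x == l y) == (y \in porbit p x)]
  && [forall i, exists x, l x == i].

Definition vertex_labelled_graph (g : nat) (mu : 'I_n -> nat) m : bool :=
  [&& embedded_graph g m, labels_cycles (vperm m) (lab m)
    & [forall i, #|[set x | lab m x == i]| == mu i]].

Definition ribbon_graph (g : nat) m : bool :=
  [&& embedded_graph g m, labels_cycles (fperm m) (lab m)
    & [forall x, 3 <= #|porbit (vperm m) x|]].

Definition is_iso m m' (f : {perm D}) : bool :=
  [forall x, [&& f (vperm m x) == vperm m' (f x),
                 f (eperm m x) == eperm m' (f x)
               & lab m' (f x) == lab m x]].

Definition isomorphic m m' : bool := [exists f, is_iso m m' f].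

Definition aut m : {set {perm D}} := [set f | is_iso m m f].

Lemma isomorphic_equiv : equivalence_rel isomorphic.
Proof.
have refl m : isomorphic m m.
  by apply/existsP; exists 1%g; apply/forallP => x; rewrite !perm1 !eqxx.
have sym m m' : isomorphic m m' -> isomorphic m' m.
  case/existsP => f /forallP isof; apply/existsP; exists f^-1%g.
  apply/forallP => x; have /and3P[/eqP ev /eqP ee /eqP el] := isof (f^-1%g x).
  rewrite permKV in ev ee el.
  by rewrite -ev -ee !permK el !eqxx.
have trans m2 m1 m3 : isomorphic m1 m2 -> isomorphic m2 m3 -> isomorphic m1 m3.
  case/existsP => f /forallP isof /existsP[h /forallP isoh].
  apply/existsP; exists (f * h)%g; apply/forallP => x; rewrite !permM.
  have /and3P[/eqP ev /eqP ee /eqP el] := isof x.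
  have /and3P[/eqP hv /eqP he /eqP hl] := isoh (f x).
  by rewrite ev ee hv he hl el !eqxx.
move=> m1 m2 m3; split=> // iso12; apply/idP/idP; last exact: trans.
exact: trans (sym _ _ iso12).
Qed.

(* Sum of w / |Aut| over the isomorphism classes of the maps in P *)
Definition iso_class_sum (P : pred (lmap D n)) (w : lmap D n -> rat) : rat :=
  let S := [set m | P m] in
  (\sum_(m in transversal (equivalence_partition isomorphic S) S)
     w m / #|aut m|%:R)%R.

Definition incidence_mx m : 'M[nat]_(n, #|edges m|) :=
  \matrix_(i, k) #|[set x in (enum_val k : {set D}) | lab m x == i]|.

(* Z_+^e is truncated to entries at most the sum of the mu i;
   incidence_sol_le shows that no solution is lost. *)
Definition num_solutions (mu : 'I_n -> nat) m : nat :=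
  #|[set x : 'cV['I_(\sum_i mu i).+1]_#|edges m| |
      [forall k, 0 < x k 0%R]
      && (incidence_mx m *m map_mx (@nat_of_ord _) x == \col_i mu i)%R]|.

Lemma incidence_sol_le (mu : 'I_n -> nat) m (x : 'cV[nat]_#|edges m|) k :
  (incidence_mx m *m x = \col_i mu i)%R -> x k 0%R <= \sum_i mu i.
Proof.
move=> eq_mu.
have /imsetP[h _ def_k] : enum_val k \in porbits (eperm m) by apply: enum_valP.
have := congr1 (fun A : 'cV[nat]_n => A (lab m h) 0%R) eq_mu.
rewrite !mxE (bigD1 k) //= mxE => eq_i.
rewrite (bigD1 (lab m h)) //= -eq_i.
have A_gt0 : 0 < #|[set y in (enum_val k : {set D}) | lab m y == lab m h]|.
  apply/card_gt0P; exists h; rewrite inE eqxx andbT def_k; exact: porbit_id.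
apply: leq_trans (leq_addr _ _); apply: leq_trans (leq_addr _ _).
exact: leq_pmull.
Qed.

Lemma partition_porbits (p : {perm D}) : partition (porbits p) [set: D].
Proof.
have -> : porbits p = equivalence_partition [rel x y | y \in porbit p x] [set: D].
  apply/setP => A; apply/imsetP/imsetP => -[x _ ->]; exists x => //;
  by apply/setP => y; rewrite !inE.
apply: equivalence_partitionP => x y z _ _ _; split; first exact: porbit_id.
by move=> /=; rewrite porbit_sym -eq_porbit_mem => /eqP ->.
Qed.

Lemma card_porbits_ge (p : {perm D}) d :
  (forall x, d <= #|porbit p x|) -> d * #|porbits p| <= #|D|.
Proof.
move=> le_d; have := partition_porbits p.
move=> /card_partition; rewrite cardsT => ->.
rewrite mulnC -sum_nat_const; apply: leq_sum => A /imsetP[x _ ->]; exact: le_d.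
Qed.

Lemma card_edges m :
  fixfree_involution (eperm m) -> 2 * #|edges m| = #|D|.
Proof.
move=> /forallP inv; have /card_partition := partition_porbits (eperm m).
rewrite cardsT => ->; rewrite mulnC -sum_nat_const.
apply: eq_bigr => A /imsetP[x _ ->]; have /andP[ne /eqP ee] := inv x.
suff -> : porbit (eperm m) x = [set x; eperm m x] by rewrite cards2 eq_sym ne.
apply/setP => y; rewrite !inE; apply/idP/idP.
  case/porbitP => i ->; elim: i => [|i]; first by rewrite expg0 perm1 eqxx.
  by rewrite expgSr permM => /orP[] /eqP ->; rewrite ?ee eqxx ?orbT.
by case/orP => /eqP ->; rewrite ?porbit_id // (mem_porbit _ 1).
Qed.

End LabelledMaps.

(* Since sum_i mu_i is the number of half-edges, these are all the graphs. *)
Definition Dgn (g n : nat) (mu : 'I_n -> nat) : rat :=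
  iso_class_sum (@vertex_labelled_graph 'I_(\sum_i mu i) n g mu) (fun=> 1%R).

(* The sum over e is truncated by ribbon_graph_edges_le. *)
Definition Ngn (g n : nat) (mu : 'I_n -> nat) : rat :=
  (\sum_(e < (6 * g + 3 * n - 6).+1)
     iso_class_sum (@ribbon_graph 'I_(2 * e) n g)
       (fun m => (num_solutions mu m)%:R))%R.

Lemma card_labels (D : finType) n (p : {perm D}) (l : {ffun D -> 'I_n}) :
  labels_cycles p l -> #|porbits p| = n.
Proof.
move=> /andP[/forallP same /forallP surj].
have sameP x y : l x = l y <-> porbit p x = porbit p y.
  have /forallP/(_ y)/eqP := same x; rewrite porbit_sym -eq_porbit_mem.
  by move=> e; split=> /eqP; [rewrite e | rewrite -e] => /eqP.
pose F i := porbit p (xchoose (existsP (surj i))).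
have lF i : l (xchoose (existsP (surj i))) = i.
  exact/eqP/(xchooseP (existsP (surj i))).
have injF : injective F by move=> i j /sameP; rewrite !lF.
rewrite -[RHS]card_ord -(card_imset _ injF); apply: eq_card => A.
apply/imsetP/imsetP => [[x _ ->]|[i _ ->]]; last by exists (xchoose (existsP (surj i))).
by exists (l x) => //; apply/sameP; rewrite lF.
Qed.

Lemma ribbon_graph_edges_le g n e (m : lmap 'I_(2 * e) n) :
  ribbon_graph g m -> e <= 6 * g + 3 * n - 6.
Proof.
case/and3P => /and3P[inv _ /eqP euler] lab_m /forallP deg3.
have := card_edges inv; have := card_porbits_ge deg3.
rewrite (card_labels lab_m) card_ord in euler * => le3 eqe.
by lia.
Qed.

(* Main.v *)
Require Import Defs.
From mathcomp Require Import all_boot all_order all_algebra fingroup perm.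
From mathcomp Require Import zify ring.
Import GRing.Theory.

Set Implicit Arguments.
Unset Strict Implicit.
Unset Printing Implicit Defensive.

(* All weighted counts become counts of maps on a fixed set of N half-edges,  *)
(* divided by N!. In the vertex-labelled picture of D, a face of degree 1 is  *)
(* bounded by a contractible loop, and a face of degree 2 by parallel edges.  *)
(* Removing a marked monogon and recording the corner where it was gives a    *)
(* recursion for the factorial moments of the numbers of monogons; inclusion- *)
(* exclusion then writes the count of maps without monogons as a signed       *)
(* Chebyshev-type sum of the D's, which is inverted by the binomial weights   *)
(* of the theorem. Removing a marked bigon, while adding up the lengths of    *)
(* the two edges it glues, shows that maps without monogons are counted by    *)
(* maps without monogons and bigons that carry positive integer edge lengths; *)
(* dually these are the metric ribbon graphs with vertices of degree >= 3     *)
(* counted by N.                                                              *)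

(** * Inserting a point into a cycle of a permutation *)

(** By orbit-stabilizer ([iso_class_sumE]) a sum of 1/|Aut| over isomorphism classes is a number of
    maps on N fixed half-edges divided by N!, so edges can be inserted and deleted without tracking
    automorphisms. All counting is done with labelled vertices; N_{g,n} enters through [dual]. The
    condition 2g - 2 + n > 0 ensures that deleting an edge of a monogon or bigon leaves a map
    ([no_isolated_edge]).

    Monogons. Let M(mu, s) be [monogon_moment], the normalized count of maps with s_i selected
    monogons at vertex i. Deleting one selected monogon leaves a corner, whence (s_i + 1) M(mu +
    2e_i, s + e_i) = (mu_i - s_i) M(mu, s), and M(mu, s) is the product of the binomials C(mu_i -
    s_i - 1, s_i) times D(mu - 2s) ([monogon_momentE]). Inclusion-exclusion over s isolates the maps
    without monogons ([monogon_free_countE]). The coefficients are those of the Chebyshev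
    polynomials U_{nu-1}(x/2), so the inverse expands x^{mu-1} in these polynomials; its
    coefficients are the ballot numbers (2l - mu)/mu C(mu, l) of the theorem ([pruning_inversion]).

    Bigons. Let B(N, k) be [bigon_moment], the normalized count of monogon-free maps with N
    half-edges, k bigon sides and positive edge lengths whose sum at vertex i is nu_i; put M = nu_1
    + ... + nu_n. An edge of length c(b) splits into two parallel edges in c(b) - 1 ways, and these
    numbers add up over the half-edges b to M - N. Hence k B(N+2, k) = (M - N) B(N, k-2), which
    gives B(M, M - N) = B(N, 0) ([bigon_moment_diag]). On M half-edges every length is 1, so summing
    over N equates the monogon-free count at nu with the count of metric maps having neither
    monogons nor bigons. The duals of the latter are the metric ribbon graphs of N_{g,n}(nu)
    ([Ngn_monogon_free_count]). *)

Section OptionPerm.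
Variable T : finType.
Implicit Types s : {perm T}.

Definition perm_option s : {perm option T} := perm (inj_omap (@perm_inj T s)).

Lemma perm_optionE s z : perm_option s z = omap s z.
Proof. by rewrite permE. Qed.

Lemma perm_option_inj : injective perm_option.
Proof.
move=> s1 s2 eq12; apply/permP => z.
by have := congr1 (fun s : {perm _} => s (Some z)) eq12;
  rewrite !perm_optionE => -[].
Qed.

Lemma perm_option_surj (s' : {perm option T}) :
  s' None = None -> exists s, s' = perm_option s.
Proof.
move=> s'N; pose s z := odflt z (s' (Some z)).
have sE z : Some (s z) = s' (Some z).
  rewrite /s; case E: (s' (Some z)) => [w|] //=.
  by have := perm_inj (etrans E (esym s'N)).
have s_inj : injective s.
  by move=> x y exy; apply: Some_inj; apply: (@perm_inj _ s'); rewrite -!sE exy.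
exists (perm s_inj); apply/permP => -[z|]; rewrite perm_optionE //=.
by rewrite permE sE.
Qed.

Lemma porbit_option_Some s z :
  porbit (perm_option s) (Some z) = Some @: porbit s z.
Proof.
have powE i : (perm_option s ^+ i)%g (Some z) = Some ((s ^+ i)%g z).
  elim: i => [|i IH]; first by rewrite !expg0 !perm1.
  by rewrite !expgSr !permM IH perm_optionE.
apply/setP => w; apply/porbitP/imsetP.
  by case=> i ->; exists ((s ^+ i)%g z); rewrite ?mem_porbit ?powE.
by case=> _ /porbitP[i ->] ->; exists i; rewrite powE.
Qed.

Lemma porbit_option_None s : porbit (perm_option s) None = [set None].
Proof.
apply/setP => w; rewrite inE; apply/porbitP/eqP => [[i ->]|->].
  by elim: i => [|i IH]; rewrite ?expg0 ?perm1 // expgSr permM IH perm_optionE.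
by exists 0; rewrite expg0 perm1.
Qed.

Lemma card_porbits_option s : #|porbits (perm_option s)| = #|porbits s|.+1.
Proof.
have -> : porbits (perm_option s)
    = [set None] |: [set (fun A : {set T} => Some @: A) A | A in porbits s].
  apply/setP => A; rewrite !inE; apply/imsetP/orP.
    case=> -[z|] _ ->; last by rewrite porbit_option_None eqxx; left.
    by right; rewrite porbit_option_Some; apply: imset_f; apply: imset_f.
  case=> [/eqP ->|/imsetP[_ /imsetP[z _ ->] ->]].
    by exists None; rewrite ?porbit_option_None.
  by exists (Some z); rewrite ?porbit_option_Some.
rewrite cardsU1 card_imset; last first.
  by apply: imset_inj; move=> x y [].
case: imsetP => // -[_ /imsetP[z _ ->] /setP/(_ None)].
by rewrite inE eqxx => /esym/imsetP[].
Qed.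

(** Products act from left to right, so the transposition comes first: p is sent to [None], and
    [None] to the former image of p. *)
Definition ins_after (p : T) s : {perm option T} :=
  (tperm None (Some p) * perm_option s)%g.

Lemma ins_after_None p s : ins_after p s None = Some (s p).
Proof. by rewrite permM tpermL perm_optionE. Qed.

Lemma ins_after_Some p s z :
  ins_after p s (Some z) = if z == p then None else Some (s z).
Proof.
rewrite permM perm_optionE; case: eqP => [->|np]; first by rewrite tpermR.
by rewrite tpermD //; apply/eqP => // -[]; auto.
Qed.

Lemma ins_after_inj p1 p2 s1 s2 :
  ins_after p1 s1 = ins_after p2 s2 -> p1 = p2 /\ s1 = s2.
Proof.
move=> eq12; suff ep : p1 = p2.
  by split=> //; move: eq12; rewrite /ins_after ep => /mulgI/perm_option_inj.
have := congr1 (fun s : {perm _} => s (Some p1)) eq12.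
by rewrite !ins_after_Some eqxx; case: eqP.
Qed.

Lemma ins_after_surj (s' : {perm option T}) :
  s' None <> None -> exists p s, s' = ins_after p s.
Proof.
move=> s'N; case E: ((s'^-1)%g None) => [p|]; last first.
  by case: s'N; rewrite -[in LHS]E permKV.
have [|s es] := @perm_option_surj (tperm None (Some p) * s')%g.
  by rewrite permM tpermL -E permKV.
by exists p, s; rewrite /ins_after -es mulgA tperm2 mul1g.
Qed.

(** Extending by the fixed point [None] creates one cycle, and the transposition merges it into the
    cycle of p. *)
Lemma card_porbits_ins_after p s : #|porbits (ins_after p s)| = #|porbits s|.
Proof.
have := porbits_mul_tperm (perm_option s) None (Some p).
rewrite /= card_porbits_option porbit_option_Some.
have -> : (None \notin Some @: porbit s p) by apply/imsetP => -[].
by rewrite /= -/(ins_after p s) addn2 addn1 => -[].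
Qed.

End OptionPerm.

Lemma card_porbits_conj (T : finType) (s t : {perm T}) :
  #|porbits (s ^ t)%g| = #|porbits s|.
Proof.
have powE i z : ((s ^ t) ^+ i)%g (t z) = t ((s ^+ i)%g z).
  by rewrite -conjXg permJ.
have porbitJ z : porbit (s ^ t)%g (t z) = t @: porbit s z.
  apply/setP => w; apply/porbitP/imsetP.
    by case=> i ->; exists ((s ^+ i)%g z); rewrite ?mem_porbit ?powE.
  by case=> _ /porbitP[i ->] ->; exists i; rewrite powE.
rewrite -(card_imset (porbits s) (imset_inj (@perm_inj _ t))).
apply: eq_card => A; apply/imsetP/imsetP.
  case=> z _ ->; exists (porbit s ((t^-1)%g z)); first exact: imset_f.
  by rewrite -porbitJ permKV.
by case=> _ /imsetP[z _ ->] ->; exists (t z); rewrite // porbitJ.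
Qed.

(** * Labelled maps and their relabellings *)

Section LabelledMaps.
Variables (T : finType) (n : nat).
Implicit Types (m : lmap T n) (g : nat).

Definition labelled_map g m :=
  embedded_graph g m && labels_cycles (vperm m) (lab m).

Definition vdeg m : {ffun 'I_n -> nat} := [ffun i => #|[set x | lab m x == i]|].

Definition monogons m (i : 'I_n) :=
  #|[set x | (fperm m x == x) && (lab m x == i)]|.

Definition no_monogon m := [forall x, fperm m x != x].

Definition on_bigon m x := (fperm m x != x) && (fperm m (fperm m x) == x).

Definition bigon_sides m := #|[set x | on_bigon m x]|.

Definition label_connected m := [forall B : {set 'I_n},
  [forall x, (lab m x \in B) ==> (lab m (eperm m x) \in B)]
    ==> (B == set0) || (B == [set: 'I_n])].

(** A surjective labelling constant on cycles is a bijection as soon as there are n cycles. Each of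
    the three conditions can be followed separately when half-edges are inserted. *)
Lemma labels_cyclesE (p : {perm T}) (l : {ffun T -> 'I_n}) :
  labels_cycles p l = [&& [forall x, l (p x) == l x],
    [forall i, exists x, l x == i] & #|porbits p| == n].
Proof.
apply/idP/idP => [lp|/and3P[/forallP lp /forallP surj /eqP card_p]].
  rewrite (card_labels lp) eqxx andbT; case/andP: lp => /forallP same ->.
  rewrite andbT; apply/forallP => x; have /forallP/(_ (p x))/eqP := same x.
  by rewrite (mem_porbit p 1) eq_sym.
have lab_porbit x y : y \in porbit p x -> l y = l x.
  case/porbitP => i ->; elim: i => [|i IH]; first by rewrite expg0 perm1.
  by rewrite expgSr permM (eqP (lp _)).
pose r i := xchoose (existsP (surj i)).
have lr i : l (r i) = i by apply/eqP/(xchooseP (existsP (surj i))).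
pose G i := porbit p (r i).
have lG i x : x \in G i -> l x = i by move/lab_porbit ->.
have G_inj : injective G.
  by move=> i j Gij; rewrite -(lG i (r j)) ?lr // Gij porbit_id.
have G_im : G @: [set: 'I_n] = porbits p.
  apply/eqP; rewrite eqEcard (card_imset _ G_inj) cardsT card_ord card_p leqnn
    andbT.
  by apply/subsetP => _ /imsetP[i _ ->]; apply: imset_f.
have porbitG x : porbit p x = G (l x).
  have : porbit p x \in porbits p by apply: imset_f.
  rewrite -G_im => /imsetP[i _ def_x].
  by rewrite def_x (lG i x) // -def_x porbit_id.
apply/andP; split; last by apply/forallP.
apply/forallP => x; apply/forallP => y; apply/eqP; apply/eqP/idP =>
  [lxy|/lab_porbit //].
by rewrite porbitG lxy -porbitG porbit_id.
Qed.

Lemma connected_mapE m :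
  labels_cycles (vperm m) (lab m) -> connected_map m = label_connected m.
Proof.
move=> lm; have := lm; rewrite labels_cyclesE => /and3P[/forallP lv _ _].
case/andP: lm => /forallP same /forallP surj.
rewrite /connected_map; set r := [rel u w | _].
apply/forallP/forallP => [conn B|conn x].
  apply/implyP => /forallP Be; have [->|[i Bi]] := set_0Vmem B;
    first by rewrite eqxx.
  apply/orP; right; apply/eqP/setP => j; rewrite inE.
  have /existsP[x /eqP lx] := surj i; have /existsP[y /eqP <-] := surj j.
  have /forallP/(_ y)/connectP[p] := conn x.
  rewrite -{i}lx in Bi.
  elim: p x Bi => [|z p IH] x Bx /=; first by move=> _ ->.
  case/andP=> /orP[] /eqP -> pz; apply: IH pz.
    by rewrite (eqP (lv x)).
  exact: (implyP (Be x)).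
have conn_porbit y z : z \in porbit (vperm m) y -> connect r y z.
  case/porbitP => i ->; elim: i => [|i IH]; first by rewrite expg0 perm1.
  apply: connect_trans IH (connect1 _).
  by rewrite /= expgSr permM eqxx.
pose B := [set lab m y | y in connect r x].
have lab_B y : (lab m y \in B) -> connect r x y.
  case/imsetP => z xz lyz; apply: connect_trans xz (conn_porbit _ _ _).
  by have /forallP/(_ y)/eqP <- := same z; rewrite lyz.
apply/forallP => y; apply: (lab_B y).
have closedB : [forall z, (lab m z \in B) ==> (lab m (eperm m z) \in B)].
  apply/forallP => z; apply/implyP => /lab_B xz; apply: imset_f.
  by apply: connect_trans xz (connect1 _); rewrite /= eqxx orbT.
have := conn B; rewrite closedB => /orP[].
- by move/eqP/setP/(_ (lab m x)); rewrite !inE imset_f // inE connect0.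
- by move/eqP->; rewrite inE.
Qed.

(** The last conjunct is Euler's relation with n vertices and |T|/2 edges, doubled to avoid the
    division. *)
Lemma labelled_mapE g m : labelled_map g m =
  [&& fixfree_involution (eperm m), label_connected m,
      [forall x, lab m (vperm m x) == lab m x],
      [forall i, exists x, lab m x == i], #|porbits (vperm m)| == n
    & 2 * (n + #|porbits (fperm m)| + 2 * g) == #|T| + 4].
Proof.
rewrite /labelled_map /embedded_graph.
have [inv|] //= := boolP (fixfree_involution _).
have [lm|] := boolP (labels_cycles _ _); last first.
  rewrite andbF labels_cyclesE => /negP nlm; apply/esym/negP.
  by case/and5P=> _ lv ls pn _; apply: nlm; rewrite lv ls pn.
rewrite andbT connected_mapE //; congr (_ && _).
have := lm; rewrite labels_cyclesE => /and3P[-> -> /eqP pn].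
rewrite /has_genus pn eqxx /= -(card_edges inv); move: #|_| #|edges m| => a b;
  apply/eqP/eqP; lia.
Qed.

End LabelledMaps.

Section Relabel.
Variables (T T' : finType) (h : T -> T') (k : T' -> T).
Hypotheses (hK : cancel h k) (kK : cancel k h).
Variable n : nat.

Definition transport_perm (s : {perm T}) : {perm T'} :=
  perm (inj_comp (can_inj hK) (inj_comp (@perm_inj T s) (can_inj kK))).

(** Two types are allowed so that this serves both for permuting the half-edges of one set and for
    replacing an ordinal type by [option (option T)]. *)
Definition relabel (m : lmap T n) : lmap T' n :=
  LMap (transport_perm (vperm m)) (transport_perm (eperm m))
       [ffun x => lab m (k x)].

Lemma transport_permE s x : transport_perm s (h x) = h (s x).
Proof. by rewrite permE /= hK. Qed.

Lemma card_porbits_transport s : #|porbits (transport_perm s)| = #|porbits s|.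
Proof.
have powE i z : (transport_perm s ^+ i)%g (h z) = h ((s ^+ i)%g z).
  elim: i => [|i IH]; first by rewrite !expg0 !perm1.
  by rewrite !expgSr !permM IH transport_permE.
have porbitJ z : porbit (transport_perm s) (h z) = h @: porbit s z.
  apply/setP => w; apply/porbitP/imsetP.
    by case=> i ->; exists ((s ^+ i)%g z); rewrite ?mem_porbit ?powE.
  by case=> _ /porbitP[i ->] ->; exists i; rewrite powE.
rewrite -(card_imset (porbits s) (imset_inj (can_inj hK))).
apply: eq_card => A; apply/imsetP/imsetP.
  case=> z _ ->; exists (porbit s (k z)); first exact: imset_f.
  by rewrite -porbitJ kK.
by case=> _ /imsetP[z _ ->] ->; exists (h z); rewrite // porbitJ.
Qed.

Lemma vperm_relabel m x : vperm (relabel m) (h x) = h (vperm m x).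
Proof. exact: transport_permE. Qed.

Lemma eperm_relabel m x : eperm (relabel m) (h x) = h (eperm m x).
Proof. exact: transport_permE. Qed.

Lemma lab_relabel m x : lab (relabel m) (h x) = lab m x.
Proof. by rewrite ffunE hK. Qed.

Lemma fperm_relabelE m : fperm (relabel m) = transport_perm (fperm m).
Proof.
by apply/permP => x; rewrite -(kK x) permM eperm_relabel vperm_relabel
  transport_permE permM.
Qed.

Lemma fperm_relabel m x : fperm (relabel m) (h x) = h (fperm m x).
Proof. by rewrite fperm_relabelE transport_permE. Qed.

Lemma forall_transport (P : pred T') : [forall x, P x] = [forall x, P (h x)].
Proof.
apply/forallP/forallP => [Ph x|Ph x]; first exact: Ph.
by rewrite -(kK x).
Qed.

Lemma card_set_transport (P : pred T') : #|[set x | P x]| = #|[set x | P (h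
  x)]|.
Proof.
rewrite -(card_imset _ (can_inj hK)); apply: eq_card => x; rewrite inE.
apply/idP/imsetP => [Px|[y]]; last by rewrite inE => Py ->.
by exists (k x); rewrite ?inE kK.
Qed.

Lemma labelled_map_relabel g m : labelled_map g (relabel m) = labelled_map g m.
Proof.
rewrite !labelled_mapE fperm_relabelE !card_porbits_transport.
have -> : #|T'| = #|T| by rewrite (bij_eq_card (Bijective hK kK)).
congr [&& _, _, _, _, _ & _].
- rewrite /fixfree_involution forall_transport; apply: eq_forallb => x.
  by rewrite !eperm_relabel !(can_eq hK).
- apply: eq_forallb => B; congr (_ ==> _); rewrite forall_transport.
  by apply: eq_forallb => x; rewrite eperm_relabel !lab_relabel.
- rewrite forall_transport; apply: eq_forallb => x.
  by rewrite vperm_relabel !lab_relabel.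
- apply: eq_forallb => i; apply/existsP/existsP => -[x lx].
    by exists (k x); rewrite -lab_relabel kK.
  by exists (h x); rewrite lab_relabel.
Qed.

Lemma vdeg_relabel m : vdeg (relabel m) = vdeg m.
Proof.
apply/ffunP => i; rewrite !ffunE card_set_transport.
by apply: eq_card => x; rewrite !inE lab_relabel.
Qed.

Lemma monogons_relabel m : monogons (relabel m) =1 monogons m.
Proof.
move=> i; rewrite /monogons card_set_transport; apply: eq_card => x.
by rewrite !inE fperm_relabel lab_relabel (can_eq hK).
Qed.

Lemma no_monogon_relabel m : no_monogon (relabel m) = no_monogon m.
Proof.
rewrite /no_monogon forall_transport; apply: eq_forallb => x.
by rewrite fperm_relabel (can_eq hK).
Qed.

Lemma on_bigon_relabel m x : on_bigon (relabel m) (h x) = on_bigon m x.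
Proof. by rewrite /on_bigon !fperm_relabel !(can_eq hK). Qed.

Lemma bigon_sides_relabel m : bigon_sides (relabel m) = bigon_sides m.
Proof.
rewrite /bigon_sides card_set_transport; apply: eq_card => x.
by rewrite !inE on_bigon_relabel.
Qed.

End Relabel.

Lemma relabelK (T T' : finType) (h : T -> T') (k : T' -> T)
    (hK : cancel h k) (kK : cancel k h) n :
  cancel (@relabel _ _ _ _ hK kK n) (@relabel _ _ _ _ kK hK n).
Proof.
case=> v e l; congr LMap; try by apply/permP => x;
  rewrite !permE /= !permE /= !hK.
by apply/ffunP => x; rewrite !ffunE hK.
Qed.

Lemma sum_relabel (R : Type) (idx : R) (op : Monoid.com_law idx)
    (T T' : finType) (h : T -> T') (k : T' -> T)
    (hK : cancel h k) (kK : cancel k h) n (P : pred (lmap T' n)) (F : lmap T' n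
      -> R) :
  \big[op/idx]_(m | P m) F m
  = \big[op/idx]_(m | P (relabel hK kK m)) F (relabel hK kK m).
Proof.
apply: reindex; exists (@relabel _ _ _ _ kK hK n) => m _; exact: relabelK.
Qed.

Lemma card_transport (T T' : finType) : #|T| = #|T'| ->
  exists (h : T -> T') (k : T' -> T), cancel h k /\ cancel k h.
Proof.
move=> eqT; exists (fun x => enum_val (cast_ord eqT (enum_rank x))).
exists (fun x => enum_val (cast_ord (esym eqT) (enum_rank x))).
by split=> x; rewrite enum_valK ?cast_ordK ?cast_ordKV enum_rankK.
Qed.

(** * Double counting over labelled half-edges *)

Definition relabel_by (D : finType) n (f : {perm D}) (m : lmap D n) :=
  relabel (permK f) (permKV f) m.

(* A marked x and its partner [eperm m x] form an ordered pair of half-edges; *)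
(* by symmetry each of the (#|T| + 2) (#|T| + 1) pairs contributes the same.  *)
Lemma sum_marked (T : finType) n (F : lmap (option (option T)) n -> option
  (option T) -> nat) :
    (forall f m x, F (relabel_by f m) (f x) = F m x) ->
    (forall m x, eperm m x = x -> F m x = 0) ->
  \sum_m \sum_x F m x
    = #|T|.+2 * #|T|.+1 * \sum_(m | eperm m None == Some None) F m None.
Proof.
move=> F_inv F_fix; set S := \sum_(m | eperm m None == _) _.
have pairE x y : y != x -> \sum_(m | eperm m x == y) F m x = S.
  move=> ne_yx; pose t := tperm None x;
    pose f := (t * tperm (t (Some None)) y)%g.
  have tN : t None = x by rewrite /t tpermL.
  have fN : f None = x.
    rewrite permM tN tpermD //.
    by apply/eqP; rewrite -tN => /perm_inj.
  have fSN : f (Some None) = y by rewrite permM tpermL.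
  rewrite (sum_relabel _ (permK f) (permKV f)) /S.
  apply: eq_big => m.
    by rewrite -fN -fSN eperm_relabel (inj_eq perm_inj).
  by rewrite -[in LHS]fN F_inv.
transitivity (\sum_(x : option (option T)) \sum_(y | y != x) \sum_(m | eperm m
  x == y) F m x).
  rewrite exchange_big; apply: eq_bigr => x _.
  rewrite [LHS](bigID (fun m => eperm m x == x)) /=.
  rewrite big1 ?add0n => [|m /eqP/F_fix //]; apply/esym.
  rewrite (exchange_big_dep (fun m => eperm m x != x)) /=; last first.
    by move=> y m ne_yx /eqP ->.
  apply: eq_bigr => m ne_m; rewrite (big_pred1 (eperm m x)) // => y /=.
  by apply/andP/eqP => [[_ /eqP]|->].
transitivity (\sum_(x : option (option T)) #|T|.+1 * S).
  apply: eq_bigr => x _; rewrite (eq_bigr (fun=> S)); last by move=> y /pairE.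
  rewrite sum_nat_const; congr (_ * _); have := cardC1 x.
  by rewrite !card_option /= => <-; apply: eq_card => y; rewrite !inE.
by rewrite sum_nat_const !card_option mulnA.
Qed.

Section IsoClassSum.
Variables (D : finType) (n : nat).
Implicit Types m : lmap D n.

Lemma is_isoE m m' f : is_iso m m' f = (m' == relabel_by f m).
Proof.
apply/forallP/eqP => [iso|-> x]; last first.
  by rewrite vperm_relabel eperm_relabel lab_relabel !eqxx.
case: m' iso => v' e' l' /= iso; congr LMap; last first.
- apply/ffunP => x; rewrite ffunE -[in l' x](permKV f x).
  by have /and3P[_ _ /eqP] := iso ((f^-1)%g x).
- apply/permP => x; rewrite -[x](permKV f) transport_permE.
  by have /and3P[_ /eqP] := iso ((f^-1)%g x).
- apply/permP => x; rewrite -[x](permKV f) transport_permE.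
  by have /and3P[/eqP] := iso ((f^-1)%g x).
Qed.

Lemma relabel_byM f1 f2 m : relabel_by (f1 * f2)%g m = relabel_by f2
  (relabel_by f1 m).
Proof.
apply/eqP; rewrite eq_sym -is_isoE; apply/forallP => x; rewrite !permM.
by rewrite !vperm_relabel !eperm_relabel !lab_relabel !eqxx.
Qed.

(** Orbit-stabilizer for the symmetric group acting by [relabel_by]: the fibres of f |->
    [relabel_by f m] are cosets of [aut m]. *)
Lemma card_iso_class m :
  #|[set m' | isomorphic m m']| * #|aut m| = (#|D|)`!.
Proof.
have -> : [set m' | isomorphic m m'] = [set relabel_by f m | f in [set: {perm
  D}]].
  apply/setP => m'; rewrite inE; apply/existsP/imsetP.
    by case=> f; rewrite is_isoE => /eqP ->; exists f.
  by case=> f _ ->; exists f; rewrite is_isoE.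
have -> : (#|D|)`! = #|[set: {perm D}]|.
  by rewrite -cardsT -card_perm; apply: eq_card => f; rewrite inE;
    apply/subsetP => x; rewrite inE.
rewrite -[RHS]sum1_card (partition_big_imset (fun f => relabel_by f m)) /=.
rewrite -sum_nat_const; apply/esym/eq_bigr => _ /imsetP[f0 _ ->].
rewrite sum1_card -(card_imset (mem (aut m)) (mulIg f0)); apply: eq_card => f.
rewrite [LHS]unfold_in inE /=; apply/eqP/imsetP; last first.
  by case=> f1; rewrite inE is_isoE => /eqP em ->; rewrite relabel_byM -em.
move=> ef; exists (f * f0^-1)%g; last by rewrite mulgKV.
by rewrite inE is_isoE relabel_byM ef -relabel_byM mulgV -is_isoE;
  apply/forallP => x; rewrite !perm1 !eqxx.
Qed.

Lemma iso_class_sumE (P : pred (lmap D n)) (w : lmap D n -> rat) :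
    (forall f m, P (relabel_by f m) = P m) ->
    (forall f m, w (relabel_by f m) = w m) ->
  (iso_class_sum P w = (\sum_(m | P m) w m) / (#|D|)`!%:R)%R.
Proof.
move=> P_inv w_inv; rewrite /iso_class_sum; set S := [set m | P m].
set Q := equivalence_partition _ S.
have equivR : {in S & &, equivalence_rel (@isomorphic D n)}.
  by move=> x y z _ _ _; exact: isomorphic_equiv.
have partQ : partition Q S := equivalence_partitionP equivR.
have trQ := transversalP partQ; set X := transversal Q S in trQ *.
have -> : (\sum_(m | P m) w m = \sum_(m in S) w m)%R.
  by apply: eq_bigl => m; rewrite inE.
rewrite [in RHS](set_partition_big _ partQ) -[in RHS](pblock_transversal trQ).
rewrite [X in (_ = X / _)%R]big_imset; last exact: (pblock_inj trQ).
rewrite mulr_suml; apply: eq_bigr => m Xm.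
have Sm := subsetP (transversal_sub trQ) _ Xm.
have blockE : pblock Q m = [set m' | isomorphic m m'].
  apply/setP => m'; rewrite inE; have [Sm'|nSm'] := boolP (m' \in S).
    by rewrite pblock_equivalence_partition.
  apply/idP/idP => [Qm'|].
    case/negP: nSm'; rewrite -(cover_partition partQ); apply/bigcupP.
    by exists (pblock Q m) => //; rewrite pblock_mem ?(cover_partition partQ).
  case/existsP => f; rewrite is_isoE => /eqP em'; case/negP: nSm'.
  by move: Sm; rewrite !inE em' P_inv.
rewrite (eq_bigr (fun=> w m)); last first.
  move=> m'; rewrite blockE inE => /existsP[f]; rewrite is_isoE => /eqP ->.
  exact: w_inv.
rewrite big_const iter_addr_0 blockE -(card_iso_class m) natrM.
have aut_neq0 : (#|aut m|%:R != 0 :> rat)%R.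
  rewrite Num.Theory.pnatr_eq0 -lt0n; apply/card_gt0P; exists 1%g.
  by rewrite inE; apply/forallP => x; rewrite !perm1 !eqxx.
have class_neq0 : (#|[set m' | isomorphic m m']|%:R != 0 :> rat)%R.
  rewrite Num.Theory.pnatr_eq0 -lt0n; apply/card_gt0P; exists m.
  by rewrite inE; case: (isomorphic_equiv m m m).
by rewrite -[X in (_ = X / _)%R]mulr_natr invfM mulrA mulfK.
Qed.

End IsoClassSum.

(** * Adding an edge *)

Section BigOption.
Variables (R : Type) (idx : R) (op : Monoid.com_law idx).

Lemma big_option (T : finType) (F : option T -> R) :
  \big[op/idx]_x F x = op (F None) (\big[op/idx]_z F (Some z)).
Proof.
rewrite (bigD1 None) //=; congr (op _ _).
rewrite (reindex_omap Some id) => [|[z|] //].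
by apply: eq_bigl => z; rewrite eqxx.
Qed.

(** Only the indices satisfying P have to be reached; here h adds an edge, and P forces the marked
    edge to be removable. *)
Lemma big_reindex_surj (I J : finType) (h : J -> I) (P : pred I) (F : I -> R) :
    injective h -> (forall i, P i -> exists j, i = h j) ->
  \big[op/idx]_(i | P i) F i = \big[op/idx]_(j | P (h j)) F (h j).
Proof.
move=> h_inj h_surj.
have -> : \big[op/idx]_(j | P (h j)) F (h j)
    = \big[op/idx]_(j in [set j | P (h j)]) F (h j).
  by apply: eq_bigl => j; rewrite inE.
rewrite -(big_imset F) /=; last by move=> x y _ _; apply: h_inj.
apply: eq_bigl => i; apply/idP/imsetP => [Pi|[j]]; last by rewrite inE => Pj ->.
by have [j ej] := h_surj i Pi; exists j; rewrite ?inE -?ej.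
Qed.

End BigOption.

Lemma card_set_sum (T : finType) (P : pred T) : #|[set x | P x]| = \sum_x P x.
Proof. by rewrite -sum1dep_card big_mkcond; apply: eq_bigr => x _;
  case: (P x). Qed.

Lemma lab_ins_after (T : finType) (A : Type) (l : option T -> A) p (s : {perm
  T}) :
  (forall x, l (ins_after p s x) = l x)
    <-> l None = l (Some p) /\ forall z, l (Some (s z)) = l (Some z).
Proof.
split=> [linv|[lN linv] [z|]]; last by rewrite ins_after_None linv lN.
  have lp : l None = l (Some p).
    by rewrite -[in RHS]linv ins_after_Some eqxx.
  split=> // z; have := linv (Some z); rewrite ins_after_Some.
  by case: eqP => // -> _; rewrite -lp -ins_after_None linv.
by rewrite ins_after_Some; case: eqP => [->|].
Qed.

Lemma fixfreeK (T : finType) (e : {perm T}) : fixfree_involution e ->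
  involutive e.
Proof. by move=> /forallP inv x; have /andP[_ /eqP] := inv x. Qed.

Section AddEdge.
Variables (T : finType) (n : nat).
Implicit Types (m : lmap T n) (p : T) (q : option T).

Definition add_pair (e : {perm T}) : {perm option (option T)} :=
  (tperm None (Some None) * perm_option (perm_option e))%g.

(* The half-edge [Some None] is inserted after p, and then [None] after q;    *)
(* q = None stands for the half-edge just inserted.                           *)
Definition add_edge m p q : lmap (option (option T)) n :=
  LMap (ins_after q (ins_after p (vperm m))) (add_pair (eperm m))
       [ffun x => match x with
                  | None => lab m (odflt p q)
                  | Some z => lab m (odflt p z)
                  end].

Lemma add_pairE e x : add_pair e x = match x with
  | None => Some None | Some None => None | Some (Some z) =>
    Some (Some (e z)) end.
Proof.
rewrite permM perm_optionE; case: x => [[z|]|]; rewrite ?tpermL ?tpermR //=.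
  by rewrite tpermD //= perm_optionE.
by rewrite perm_optionE.
Qed.

Lemma fixfree_add_pair e :
  fixfree_involution (add_pair e) = fixfree_involution e.
Proof.
apply/forallP/forallP => [inv z|inv [[z|]|]]; rewrite ?add_pairE //=.
  by have := inv (Some (Some z)); rewrite !add_pairE.
exact: inv.
Qed.

(** The first hypothesis puts the new edge at one vertex or between two vertices already joined by
    an edge, so connectedness is unchanged. The second adds one face for the one new edge, so the
    genus is unchanged. *)
Lemma labelled_map_add_edge g m p q :
    (fixfree_involution (eperm m) -> (forall x, lab m (vperm m x) = lab m x) ->
      exists2 b, lab m b = lab m p
        & lab m (odflt p q) = lab m b \/ lab m (odflt p q) = lab m (eperm m b))
          ->
    (fixfree_involution (eperm m) ->
      #|porbits (fperm (add_edge m p q))| = #|porbits (fperm m)|.+1) ->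
  labelled_map g (add_edge m p q) = labelled_map g m.
Proof.
move=> ends faces; rewrite !labelled_mapE fixfree_add_pair.
have [inv|] //= := boolP (fixfree_involution _).
have -> : [forall x, lab (add_edge m p q) (vperm (add_edge m p q) x)
                       == lab (add_edge m p q) x]
          = [forall x, lab m (vperm m x) == lab m x].
  apply/forallP/forallP => lv x; apply/eqP; move: x.
    have /lab_ins_after[_] : forall x,
      lab (add_edge m p q) (ins_after q (ins_after p (vperm m)) x)
        = lab (add_edge m p q) x by move=> x; apply/eqP/(lv x).
    by move/(lab_ins_after (fun z =>
      lab (add_edge m p q) (Some z)))=> [_ lv' x];
      have := lv' x; rewrite !ffunE.
  apply/lab_ins_after; split; first by rewrite !ffunE.
  apply/(lab_ins_after (fun z => lab (add_edge m p q) (Some z))).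
  by split=> [|z]; rewrite !ffunE //=; apply/eqP.
have [/forallP lv|] := boolP [forall x, lab m (vperm m x) == lab m x];
  last first.
  by rewrite !andbF.
rewrite /= !card_porbits_ins_after (faces inv) !card_option.
have -> : label_connected (add_edge m p q) = label_connected m.
  apply: eq_forallb => B; congr (_ ==> _).
  have [|b lb lq] := ends inv; first by move=> x; apply/eqP.
  apply/forallP/forallP => closedB x.
    by have := closedB (Some (Some x)); rewrite !ffunE add_pairE.
  rewrite !ffunE /= add_pairE.
  have Bb : (lab m b \in B) = (lab m (eperm m b) \in B).
    apply/idP/idP; first exact/implyP.
    by move: (closedB (eperm m b)); rewrite fixfreeK // => /implyP.
  case: x => [[x|]|] /=; first exact: closedB.
    by rewrite -lb; case: lq => ->; rewrite -?Bb implybb.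
  by rewrite -lb; case: lq => ->; rewrite -?Bb implybb.
have -> : [forall i, exists x, lab (add_edge m p q) x == i]
          = [forall i, exists x, lab m x == i].
  apply: eq_forallb => i; apply/existsP/existsP => -[x lx].
    by move: lx; rewrite ffunE; case: x => [[x|]|] lx; eexists; exact: lx.
  by exists (Some (Some x)); rewrite ffunE.
by do 3!congr (_ && _); move: #|porbits _| #|T| => a b; apply/eqP/eqP; lia.
Qed.

Lemma add_edge_inj m1 m2 p1 p2 q1 q2 :
  add_edge m1 p1 q1 = add_edge m2 p2 q2 -> [/\ m1 = m2, p1 = p2 & q1 = q2].
Proof.
case: m1 m2 => [v1 e1 l1] [v2 e2 l2] [] /ins_after_inj[-> /ins_after_inj[->
  ->]].
move=> /mulgI/perm_option_inj/perm_option_inj -> eql; split=> //.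
congr LMap; apply/ffunP => z.
by have := congr1 (fun l : {ffun _} => l (Some (Some z))) eql; rewrite !ffunE.
Qed.

(** The three conditions on [vperm m'] say that [None] and [Some None] do not fill up a vertex,
    separately or together; each then has an old half-edge to be inserted after. *)
Lemma add_edge_surj (m' : lmap (option (option T)) n) :
    fixfree_involution (eperm m') ->
    (forall x, lab m' (vperm m' x) = lab m' x) ->
    eperm m' None = Some None -> vperm m' None <> None ->
    vperm m' (Some None) <> Some None ->
    ~ (vperm m' None = Some None /\ vperm m' (Some None) = None) ->
  exists m p q, m' = add_edge m p q.
Proof.
case: m' => v' e' l' /= inv lv eN /ins_after_surj[q [s def_v]].
rewrite {v'}def_v in lv *.
rewrite ins_after_Some ins_after_None => v1 v2.
have sN : s None <> None.
  move=> sN; case: (None =P q) => [eq|neq]; last first.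
    by move: v1; rewrite sN; case: eqP.
  by case: v2; rewrite -eq eqxx sN.
have [p [v def_s]] := ins_after_surj sN; rewrite {s v1 v2 sN}def_s in lv *.
have eSN : e' (Some None) = None by have := fixfreeK inv None; rewrite eN.
have [|e1 def_e] := @perm_option_surj _ (tperm None (Some None) * e')%g.
  by rewrite permM tpermL.
have [|e def_e1] := @perm_option_surj _ e1.
  have := congr1 (fun s : {perm _} => s (Some None)) def_e.
  by rewrite permM tpermR eN perm_optionE /=; case: (e1 None).
have [lN /(lab_ins_after (fun z =>
  l' (Some z)))[lSN _]] := (lab_ins_after _ _ _).1 lv.
exists (LMap v e [ffun z => l' (Some (Some z))]), p, q; congr LMap.
  by rewrite /add_pair /= -def_e1 -def_e mulgA tperm2 mul1g.
apply/ffunP => -[[z|]|]; rewrite !ffunE //= lN.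
by case: q {lN lv} => [z|]; rewrite ?lSN //= ffunE.
Qed.

End AddEdge.

(* An edge both of whose ends are confined to its own two half-edges is a     *)
(* whole component: a loop bounding two discs or a segment, both on a sphere. *)
Lemma no_isolated_edge (T : finType) n g (m : lmap T n) x :
    2 < 2 * g + n -> labelled_map g m ->
    vperm m x \in [set x; eperm m x] ->
    vperm m (eperm m x) \in [set x; eperm m x] -> False.
Proof.
move=> stable lm vx vex; set A := [set x; eperm m x] in vx vex *.
have := lm; rewrite labelled_mapE => /and5P[inv _ _ _ /andP[_ /eqP euler]].
have closedA y : y \in A -> (vperm m y \in A) && (eperm m y \in A).
  by rewrite !inE => /orP[] /eqP ->;
    rewrite ?fixfreeK // eqxx ?orbT andbT -!in_set2.
have le2 : #|T| <= 2.
  have sub : [set: T] \subset A.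
    apply/subsetP => y _; have := lm.
    case/andP => /and3P[_ /forallP/(_ x)/forallP/(_ y)/connectP[p pathp lastp]
      _] _.
    move: pathp lastp; have : x \in A by rewrite !inE eqxx.
    elim: p {1 2 3}x => [|z p IH] w Aw /=; first by move=> _ ->.
    have /andP[Avw Aew] := closedA _ Aw.
    by case/andP=> /orP[] /eqP ->; apply: IH.
  rewrite -cardsT; apply: leq_trans (subset_leq_card sub) _.
  by rewrite cards2; case: (_ != _).
have : 0 < #|porbits (fperm m)|.
  by apply/card_gt0P; exists (porbit (fperm m) x); apply: imset_f.
move: le2 euler; move: #|T| #|porbits _| => a b; lia.
Qed.

(** * Adding and removing a monogon or a bigon *)

Section AddMonogonBigon.
Variables (T : finType) (n : nat).
Implicit Types (m : lmap T n) (p b : T).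

Definition add_monogon m p := add_edge m p None.

Definition add_bigon m b :=
  add_edge m ((vperm m)^-1 b)%g (Some (eperm m b)).

(** [None] is the inner side of the new loop. Its outer side [Some None] joins the face crossing the
    corner after p, which steps from [eperm m p] to [vperm m p]. *)
Lemma fperm_add_monogon m p : fixfree_involution (eperm m) ->
  fperm (add_monogon m p)
    = perm_option (ins_after (eperm m p) (fperm m)).
Proof.
move=> inv; apply/permP => x;
  rewrite permM add_pairE perm_optionE /add_monogon /add_edge.
case: x => [[z|]|] /=.
- rewrite !ins_after_Some /= permM.
  by rewrite (can2_eq (fixfreeK inv) (fixfreeK inv)); case: eqP.
- by rewrite !ins_after_None permM fixfreeK.
- by rewrite ins_after_Some.
Qed.

(** The conjugation lets [Some None] take the place of b in its old face; b itself then forms a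
    2-cycle with [None], the new bigon. *)
Lemma fperm_add_bigon m b : fixfree_involution (eperm m) ->
  fperm (add_bigon m b)
    = ins_after (Some b) (perm_option (fperm m) ^ tperm None (Some b))%g.
Proof.
move=> inv; apply/permP => x; rewrite permM add_pairE /add_bigon /add_edge.
have permJE (s t : {perm option T}) z : (s ^ t)%g z = t (s ((t^-1)%g z)).
  by rewrite -permJ permKV.
case: x => [[z|]|] /=.
- rewrite !ins_after_Some !(inj_eq Some_inj) (inj_eq perm_inj).
  case: (z =P b) => // ne_zb.
  rewrite permJE tpermV (@tpermD _ _ _ (Some z)) ?perm_optionE //=; last first.
    by apply/eqP => -[/esym].
  rewrite -(inj_eq (@perm_inj _ (vperm m))) permKV permM.
  by case: eqP => [->|nb]; rewrite ?tpermR ?tpermD //; apply/eqP => -[/esym].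
- rewrite ins_after_None !ins_after_Some /= permJE tpermV tpermL perm_optionE
  /=.
  rewrite -(inj_eq (@perm_inj _ (vperm m))) permKV permM.
  by case: eqP => [->|nb]; rewrite ?tpermR ?tpermD //; apply/eqP => -[/esym].
- rewrite ins_after_Some /= !ins_after_None permJE tpermV tpermR perm_optionE
  /=.
  by rewrite tpermL permKV.
Qed.

Lemma labelled_add_monogon g m p :
  labelled_map g (add_monogon m p) = labelled_map g m.
Proof.
apply: labelled_map_add_edge => [_ _|inv]; first by exists p => //; left.
by rewrite fperm_add_monogon // card_porbits_option card_porbits_ins_after.
Qed.

Lemma labelled_add_bigon g m b :
  labelled_map g (add_bigon m b) = labelled_map g m.
Proof.
apply: labelled_map_add_edge => [inv lv|inv].
  by exists b; [rewrite -[in LHS](permKV (vperm m) b) lv | right].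
by rewrite fperm_add_bigon // card_porbits_ins_after card_porbits_conj
  card_porbits_option.
Qed.

Lemma add_monogon_inj : injective (fun mp => add_monogon mp.1 mp.2).
Proof. by move=> [m1 p1] [m2 p2] /= /add_edge_inj[-> -> _]. Qed.

Lemma add_bigon_inj : injective (fun mb => add_bigon mb.1 mb.2).
Proof.
by move=> [m1 b1] [m2 b2] /= /add_edge_inj[-> /perm_inj -> _].
Qed.

Variables (g : nat).
Hypothesis stable : 2 < 2 * g + n.

(** A loop that bounds a monogon and has no other half-edge at its vertex is an isolated edge, which
    stability excludes. *)
Lemma add_monogon_surj (m' : lmap (option (option T)) n) :
    labelled_map g m' -> eperm m' None = Some None -> fperm m' None = None ->
  exists m p, m' = add_monogon m p.
Proof.
move=> lm eN fN; have := lm; rewrite labelled_mapE.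
case/and5P => inv _ /forallP lv _ _.
have vSN : vperm m' (Some None) = None by move: fN; rewrite permM eN.
have vN : vperm m' None <> Some None.
  move=> vN; apply: (@no_isolated_edge _ _ _ m' None stable lm).
    by rewrite vN eN !inE eqxx orbT.
  by rewrite eN vSN !inE eqxx.
have [||||m [p [q em]]] := add_edge_surj inv _ eN.
- by move=> x; apply/eqP.
- by move=> vNN; have := perm_inj (etrans vNN (esym vSN)).
- by rewrite vSN.
- by case.
exists m, p; rewrite em; congr add_edge.
by move: vSN; rewrite em /= ins_after_Some; case: eqP.
Qed.

Lemma add_bigon_surj (m' : lmap (option (option T)) n) :
    labelled_map g m' -> eperm m' None = Some None -> on_bigon m' None ->
  exists m b, m' = add_bigon m b.
Proof.
move=> lm eN /andP[f1 /eqP f2]; have := lm; rewrite labelled_mapE.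
case/and5P => inv _ /forallP lv _ _.
have eSN : eperm m' (Some None) = None by rewrite -[in LHS]eN fixfreeK.
move: f1 f2; rewrite !permM eN => v1 v2.
(* The excluded case is a bigon with both sides on the same edge: that edge is a segment with two
   ends of degree 1, hence isolated. *)
case def_b : (vperm m' (Some None)) v1 v2 => [[b|]|] // _; last first.
  rewrite eSN => vN; case: (@no_isolated_edge _ _ _ m' None stable lm).
    by rewrite vN !inE eqxx.
  by rewrite eN def_b !inE eqxx orbT.
move=> va; have vN : vperm m' None <> None.
  by move=> vN; have := perm_inj (etrans va (esym vN)); rewrite -eSN =>
    /perm_inj.
have [|||m [p [q em]]] := add_edge_surj inv _ eN vN.
- by move=> x; apply/eqP.
- by rewrite def_b.
- by rewrite def_b => -[].
exists m, b; rewrite em; congr add_edge.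
  apply: (canRL (permK _)); move: def_b; rewrite em /= ins_after_Some.
  by case: eqP => // _; rewrite ins_after_None => -[].
by move: va; rewrite em /= add_pairE ins_after_Some; case: eqP.
Qed.

End AddMonogonBigon.

(** * Monogons *)

Section MonogonSum.
Variables (n g : nat).
Hypothesis stable : 2 < 2 * g + n.

Lemma vdeg_add_edge (T : finType) (m : lmap T n) p q i :
  vdeg (add_edge m p q) i
    = vdeg m i + (lab m p == i) + (lab m (odflt p q) == i).
Proof.
rewrite !ffunE !card_set_sum !big_option !ffunE /=.
rewrite addnC -addnA addnC addnAC; congr (_ + _ + _).
by apply: eq_bigr => z _; rewrite ffunE.
Qed.

Lemma monogons_add_monogon (T : finType) (m : lmap T n) p i :
    fixfree_involution (eperm m) -> (forall x, lab m (vperm m x) = lab m x) ->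
  monogons (add_monogon m p) i
    = monogons m i - ((lab m p == i) && (vperm m p == eperm m p)) + (lab m p ==
      i).
Proof.
move=> inv lv; rewrite /monogons !card_set_sum fperm_add_monogon // !big_option.
rewrite !perm_optionE /= ins_after_None /= !ffunE add0n addnC; congr (_ + _).
rewrite (bigD1 (eperm m p)) //= [in RHS](bigD1 (eperm m p)) //=.
rewrite perm_optionE /= ins_after_Some eqxx add0n permM fixfreeK //.
rewrite [X in _ = (nat_of_bool X + _) - _](_ : _ = (lab m p == i) && (vperm m p
  == eperm m p)).
  rewrite addKn; apply: eq_bigr => z /negbTE nz.
  by rewrite perm_optionE /= ins_after_Some nz ffunE.
by rewrite andbC; case: (_ =P eperm m p) => [<-|_]; rewrite ?andbF // lv.
Qed.

(** Counts maps in which [s i] of the monogons at vertex i are selected. *)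
Definition monogon_sum (T : finType) (mu s : {ffun 'I_n -> nat}) :=
  \sum_(m : lmap T n | labelled_map g m && (vdeg m == mu))
    \prod_i 'C(monogons m i, s i).

Lemma card_end_of_monogon (T : finType) (m : lmap T n) i :
    fixfree_involution (eperm m) -> (forall x, lab m (vperm m x) = lab m x) ->
  #|[set p | (lab m p == i) && (vperm m p == eperm m p)]| = monogons m i.
Proof.
move=> inv lv; rewrite -(card_imset _ (@perm_inj _ (eperm m))).
apply: eq_card => x; rewrite [RHS]inE permM.
apply/imsetP/andP => [[p]|[/eqP vx /eqP lx]].
  rewrite inE => /andP[lp /eqP vp] ->; rewrite fixfreeK // vp.
  by rewrite -[in lab m _]vp lv.
exists (eperm m x); last by rewrite fixfreeK.
by rewrite inE fixfreeK // vx -lv vx lx !eqxx.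
Qed.

(* A loop added at one of the corners p with [vperm m p = eperm m p] lies     *)
(* inside a monogon of m, which stops being one.                              *)
Lemma sum_corners (T : finType) (m : lmap T n) i s :
    fixfree_involution (eperm m) -> (forall x, lab m (vperm m x) = lab m x) ->
  \sum_(p | lab m p == i) 'C(monogons m i - (vperm m p == eperm m p), s)
    = (vdeg m i - s) * 'C(monogons m i, s).
Proof.
move=> inv lv; rewrite (bigID (fun p => vperm m p == eperm m p)) /=.
set k := monogons m i.
rewrite (eq_bigr (fun=> 'C(k.-1, s))) => [|p /andP[_ ->]];
  last by rewrite subn1.
rewrite [X in _ + X](eq_bigr (fun=> 'C(k, s))) => [|p /andP[_ /negbTE->]];
  last by rewrite subn0.
rewrite !sum_nat_const.
have := card_end_of_monogon i inv lv; rewrite cardsE => ->.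
have kE : vdeg m i = k + #|[pred p | (lab m p == i) && (vperm m p != eperm m
  p)]|.
  rewrite ffunE /k -(card_end_of_monogon i inv lv) -!sum1dep_card -sum1_card.
  by rewrite (bigID (fun p => vperm m p == eperm m p)).
(* The k corners inside monogons give k C(k-1, s) = (k-s) C(k, s), the others (deg - k) C(k, s). If
   s > k, both sides vanish. *)
rewrite kE mul_bin_down -mulnDl.
by case: (leqP s k) => [/addnBAC ->|/bin_small ->] //; rewrite !muln0.
Qed.

(** Double counting of one distinguished monogon among the selected ones at vertex i: it is removed,
    and [sum_corners] counts the corners where it can be put back. *)
Lemma monogon_sum_rec (T : finType) (mu s : {ffun 'I_n -> nat}) i :
  (s i).+1 * monogon_sum (option (option T))
      [ffun j => mu j + 2 * (j == i)] [ffun j => s j + (j == i)]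
    = #|T|.+2 * #|T|.+1 * ((mu i - s i) * monogon_sum T mu s).
Proof.
set mu2 := [ffun j => mu j + _]; set s2 := [ffun j => s j + _].
(* The weight comes from (s+1) C(k, s+1) = k C(k-1, s), where the factor k is the choice of the
   marked monogon x. *)
pose F (m : lmap (option (option T)) n) x :=
  if [&& labelled_map g m, vdeg m == mu2, fperm m x == x & lab m x == i]
  then 'C((monogons m i).-1, s i) * \prod_(j | j != i) 'C(monogons m j, s j)
  else 0.
transitivity (\sum_m \sum_x F m x).
  rewrite /monogon_sum big_distrr /= big_mkcond; apply: eq_bigr => m _.
  rewrite /F; case: (labelled_map g m); last by rewrite /= big1.
  case: (vdeg m == mu2) => /=; last by rewrite /= big1.
  rewrite -big_mkcond sum_nat_const -cardsE mulnA mul_bin_diag -mulnA.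
  rewrite (bigD1 i) //= ffunE eqxx addn1; congr (_ * (_ * _)).
  by apply: eq_bigr => j /negbTE nji; rewrite ffunE nji addn0.
rewrite sum_marked; last 2 first.
- move=> f m x; rewrite /F labelled_map_relabel vdeg_relabel fperm_relabel.
  rewrite lab_relabel (inj_eq perm_inj) monogons_relabel.
  by under eq_bigr do rewrite monogons_relabel.
- move=> m x ex; rewrite /F labelled_mapE; case: ifP =>
  // /andP[/andP[/forallP/(_ x)]].
  by rewrite ex eqxx.
congr (_ * _).
rewrite /F -big_mkcondr /=.
rewrite (big_reindex_surj _ _ (@add_monogon_inj T n)); last first.
  move=> m' /andP[/eqP eN /and4P[lm _ /eqP fN _]].
  by have [m [p ->]] := add_monogon_surj stable lm eN fN; exists (m, p).
pose w (m : lmap T n) p := 'C(monogons m i - (vperm m p == eperm m p), s i)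
  * \prod_(j | j != i) 'C(monogons m j, s j).
transitivity (\sum_(mp : lmap T n * T | (labelled_map g mp.1 && (vdeg mp.1 ==
  mu))
    && (lab mp.1 mp.2 == i)) w mp.1 mp.2).
  have labelledP (m : lmap T n) : labelled_map g m ->
      fixfree_involution (eperm m) /\ forall x, lab m (vperm m x) = lab m x.
    rewrite labelled_mapE => /and4P[inv _ /forallP lv _].
    by split=> // x; apply/eqP.
  apply: eq_big => [] [m p] /=;
    rewrite labelled_add_monogon add_pairE eqxx ffunE /=.
    have [/labelledP[inv lv]|] //= := boolP (labelled_map g m).
    rewrite fperm_add_monogon // perm_optionE eqxx /=.
    case: (lab m p =P i) => [lp|]; rewrite ?andbF ?andbT //.
    apply/eqP/eqP => [/ffunP eq_deg|eq_deg]; apply/ffunP => j.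
      have := eq_deg j; rewrite vdeg_add_edge /= lp [RHS]ffunE eq_sym.
      by rewrite -addnA addnn -mul2n => /addIn.
    by rewrite vdeg_add_edge /= lp [RHS]ffunE eq_deg eq_sym -addnA addnn -mul2n.
  case/and4P => /labelledP[inv lv] _ _ /eqP lp; rewrite /w.
  congr (_ * _).
    by rewrite monogons_add_monogon // lp eqxx addn1.
  apply: eq_bigr => j; rewrite eq_sym => /negbTE ni.
  by rewrite monogons_add_monogon // lp ni subn0 addn0.
rewrite -(pair_big_dep (fun m => labelled_map g m && (vdeg m == mu))
  (fun m p => lab m p == i) w) /monogon_sum big_distrr.
apply: eq_bigr => m /andP[lm /eqP <-].
move: lm; rewrite labelled_mapE => /and4P[inv _ /forallP lv _].
rewrite -big_distrl /= sum_corners // => [|x]; last exact/eqP.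
by rewrite -mulnA [in RHS](bigD1 i).
Qed.

End MonogonSum.

(** * Solution of the monogon recursion and inclusion-exclusion *)

Section MonogonCount.
Variables (n g : nat).
Hypothesis stable : 2 < 2 * g + n.
Implicit Types mu s : {ffun 'I_n -> nat}.
Local Open Scope ring_scope.

Lemma monogon_sum_transport (T T' : finType) mu s : #|T| = #|T'| ->
  monogon_sum g T mu s = monogon_sum g T' mu s.
Proof.
case/card_transport => h [k [hK kK]]; rewrite /monogon_sum.
rewrite [RHS](sum_relabel _ hK kK); apply: eq_big => m.
  by rewrite labelled_map_relabel vdeg_relabel.
by move=> _; apply: eq_bigr => i _; rewrite monogons_relabel.
Qed.

Lemma sum_indicator_ord i : (\sum_(j < n) (j == i) = 1)%N.
Proof. by rewrite (bigD1 i) //= eqxx big1 // => j /negbTE ->. Qed.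

Definition monogon_moment mu s : rat :=
  (monogon_sum g 'I_(\sum_i mu i) mu s)%:R / ((\sum_i mu i)`!)%:R.

Lemma monogon_moment_rec mu s i :
  (s i).+1%:R * monogon_moment [ffun j => mu j + 2 * (j == i)]%N [ffun j =>
    s j + (j == i)]%N
    = (mu i - s i)%N%:R * monogon_moment mu s.
Proof.
set N := (\sum_j mu j)%N.
have sum2 : (\sum_j [ffun j => mu j + 2 * (j == i)] j)%N = N.+2.
  under eq_bigr do rewrite ffunE.
  by rewrite big_split /= -big_distrr /= sum_indicator_ord addn2.
rewrite /monogon_moment sum2.
rewrite (@monogon_sum_transport _ (option (option 'I_N))) ?card_option
  ?card_ord //.
rewrite mulrA -natrM monogon_sum_rec // card_ord !factS !natrM -/N.
have neq0 k : (0 < k)%N -> k%:R != 0 :> rat by rewrite Num.Theory.pnatr_eq0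
  -lt0n.
by field; rewrite nat1r -natrD !neq0 ?fact_gt0.
Qed.

(** Every vertex has degree at least 1, and at least 2 if it carries a monogon, since the loop has
    both ends there. *)
Lemma monogon_sum0 (T : finType) mu s i : (mu i <= (0 < s i))%N ->
  monogon_sum g T mu s = 0%N.
Proof.
move=> mu_i; rewrite /monogon_sum big1 // => m /andP[lm /eqP deg_m].
have := lm; rewrite labelled_mapE.
case/and5P => inv _ /forallP lv /forallP/(_ i)/existsP[x lx] _.
have deg_gt0 : (0 < mu i)%N.
  by rewrite -deg_m ffunE; apply/card_gt0P; exists x; rewrite inE.
case: (posnP (s i)) mu_i => [_|s_gt0 le1]; first by rewrite leqNgt deg_gt0.
rewrite (bigD1 i) //= bin_small ?mul0n //.
suff -> : monogons m i = 0%N by [].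
apply/eqP/negPn; rewrite -lt0n; apply/negP => /card_gt0P[y].
rewrite inE permM => /andP[/eqP fy ly].
suff : (1 < mu i)%N by rewrite ltnNge le1.
rewrite -deg_m ffunE; apply: (@leq_trans #|[set y; eperm m y]|).
  by have /forallP/(_ y)/andP[ne _] := inv; rewrite cards2 eq_sym ne.
apply/subset_leq_card/subsetP => z; rewrite !inE.
by case/orP => /eqP -> //; rewrite -(eqP (lv _)) fy.
Qed.

(** The recursion is unwound one selected monogon at a time, using (s+1) C(mu-s, s+1) = (mu-s)
    C(mu-s-1, s). *)
Lemma monogon_momentE mu s : monogon_moment mu s
  = (\prod_i 'C(mu i - s i - 1, s i)%N)%:R
      * monogon_moment [ffun i => mu i - 2 * s i]%N [ffun=> 0%N].
Proof.
have [k le_k] := ubnP (\sum_i s i)%N; elim: k => // k IH in mu s le_k *.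
have [/forallP s0|] := boolP [forall i, s i == 0%N].
  rewrite big1 ?mul1r => [|i _]; last by rewrite (eqP (s0 i)) bin0.
  congr monogon_moment; apply/ffunP => i; rewrite ffunE (eqP (s0 i)) //.
  by rewrite muln0 subn0.
case/forallPn => i s_neq0.
(* A vertex of degree at most 1 has no monogon to select; on the right the truncated degree
   [mu i - 2 * s i] is 0, so both sides vanish. *)
have [mu_small|mu_big] := leqP (mu i) 1.
  rewrite /monogon_moment (@monogon_sum0 _ mu s i) ?lt0n ?s_neq0 //.
  by rewrite (@monogon_sum0 _ _ _ i) ?ffunE ?ltnn ?mul0r ?mulr0 //; lia.
pose mu0 := [ffun j => mu j - 2 * (j == i)]%N.
pose s0 := [ffun j => s j - (j == i)]%N.
have muE : mu = [ffun j => mu0 j + 2 * (j == i)]%N.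
  by apply/ffunP => j; rewrite !ffunE; case: eqP => [->|_] /=;
    clear -mu_big s_neq0; lia.
have sE : s = [ffun j => s0 j + (j == i)]%N.
  by apply/ffunP => j; rewrite !ffunE; case: eqP => [->|_] /=;
    clear -mu_big s_neq0; lia.
have neq0 : (s0 i).+1%:R != 0 :> rat by rewrite Num.Theory.pnatr_eq0.
apply: (mulfI neq0); rewrite {1}muE {1}sE monogon_moment_rec IH; last first.
  rewrite sE in le_k; move: le_k; under eq_bigr do rewrite ffunE.
  by rewrite big_split /= sum_indicator_ord addn1.
have -> : [ffun j => mu0 j - 2 * s0 j]%N = [ffun j => mu j - 2 * s j]%N.
  by apply/ffunP => j; rewrite !ffunE; case: eqP => [->|_] /=;
    clear -mu_big s_neq0; lia.
move: (monogon_moment _ [ffun=> 0%N]) => c.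
rewrite !mulrA; congr (_ * c); rewrite -!natrM; congr (_%:R);
  rewrite (bigD1 i) //= [in RHS](bigD1 i) //= !mulnA.
congr (_ * _)%N.
  have -> : s i = (s0 i).+1 by rewrite [in LHS]sE ffunE eqxx addn1.
  have -> : mu i = (mu0 i).+2 by rewrite [in LHS]muE ffunE eqxx addn2.
  have -> : ((mu0 i).+2 - (s0 i).+1 - 1 = mu0 i - s0 i)%N by lia.
  by rewrite -mul_bin_diag subn1.
by apply: eq_bigr => j /negbTE nji; rewrite !ffunE nji !subn0.
Qed.

Definition map_count mu : rat := monogon_moment mu [ffun=> 0%N].

Lemma map_count_eq0 mu i : mu i = 0%N -> map_count mu = 0.
Proof.
by move=> mu_i; rewrite /map_count /monogon_moment (@monogon_sum0 _ _ _ i)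
  ?mu_i ?mul0r.
Qed.

Definition monogon_free_count mu : rat :=
  #|[set m : lmap 'I_(\sum_i mu i) n
      | [&& labelled_map g m, vdeg m == mu & no_monogon m]]|%:R
    / (\sum_i mu i)`!%:R.

(** This is (1 - 1)^k, padded with zero terms up to a bound K common to all vertices. *)
Lemma alternating_bin_sum k K : (k < K)%N ->
  \sum_(j < K) (-1) ^+ j * 'C(k, j)%:R = (k == 0)%N%:R :> rat.
Proof.
move=> lt_kK; have := exprDn (1 : rat) (-1) k.
rewrite subrr expr0n => ->.
rewrite (big_ord_widen K (fun j => (1 ^+ (k - j) * (-1) ^+ j) *+ 'C(k, j))) //.
rewrite [LHS](bigID (fun j : 'I_K => (j < k.+1)%N)) /=.
rewrite [X in _ + X]big1 ?addr0 => [|j]; last first.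
  by rewrite -leqNgt => /bin_small ->; rewrite mulr0.
by apply: eq_bigr => j _; rewrite expr1n mul1r mulr_natr.
Qed.

Lemma monogons_le_vdeg (T : finType) (m : lmap T n) i : (monogons m i <= vdeg m
  i)%N.
Proof.
rewrite ffunE; apply/subset_leq_card/subsetP => x.
by rewrite !inE => /andP[].
Qed.

Lemma no_monogonE (T : finType) (m : lmap T n) :
  no_monogon m = [forall i, monogons m i == 0%N].
Proof.
apply/forallP/forallP => [mono i|mono x].
  apply/eqP/eq_card0 => x; rewrite inE; apply/negbTE.
  by rewrite (negbTE (mono x)).
apply/eqP => fx; have /eqP/card0_eq/(_ x) := mono (lab m x).
by rewrite inE fx !eqxx.
Qed.

Lemma monogon_free_countE mu K : (forall i, mu i < K)%N ->
  monogon_free_count mu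
    = \sum_(s : {ffun 'I_n -> 'I_K})
        \prod_i ((-1) ^+ s i * 'C(mu i - s i - 1, s i)%:R)
          * map_count [ffun i => mu i - 2 * s i]%N.
Proof.
move=> lt_mu.
transitivity (\sum_(s : {ffun 'I_n -> 'I_K})
    (\prod_i (-1) ^+ s i) * monogon_moment mu [ffun i => s i : nat]);
      last first.
  apply: eq_bigr => s _; rewrite monogon_momentE big_split /= natr_prod -mulrA.
  congr (_ * (_ * _)); first by apply: eq_bigr => i _; rewrite ffunE.
  by congr monogon_moment; apply/ffunP => i; rewrite !ffunE.
rewrite /monogon_moment; under [RHS]eq_bigr do rewrite mulrA.
rewrite -mulr_suml; congr (_ / _).
under [RHS]eq_bigr do rewrite /monogon_sum natr_sum big_distrr.
rewrite exchange_big /= -sum1_card natr_sum.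
transitivity (\sum_(m : lmap 'I_(\sum_i mu i) n
    | (labelled_map g m && (vdeg m == mu)) && no_monogon m) (1 : rat)).
  by apply: eq_bigl => m; rewrite inE andbA.
rewrite big_mkcondr; apply: eq_bigr => m /andP[_ /eqP deg_m].
transitivity (\prod_i \sum_(j < K) (-1) ^+ j * 'C(monogons m i, j)%:R : rat).
  rewrite [RHS](eq_bigr (fun i : 'I_n => (monogons m i == 0%N)%:R : rat)) =>
    [|i _]; last first.
    by rewrite alternating_bin_sum // (leq_ltn_trans (monogons_le_vdeg m i))
      ?deg_m.
  rewrite no_monogonE; case: forallP => [all0|/forallP/forallPn[i ne0]].
    by rewrite big1 // => i _; rewrite all0.
  by rewrite (bigD1 i) //= (negbTE ne0) mul0r.
rewrite bigA_distr_bigA; apply: eq_bigr => s _.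
by rewrite natr_prod -big_split; apply: eq_bigr => i _; rewrite ffunE.
Qed.

End MonogonCount.

(** * Inversion of the monogon sieve *)

Section ChebyshevInversion.
Local Open Scope ring_scope.

(** The coefficient of x^r in (1+x)^(-N) (1+x)^M, as (-1)^s C(N+s-1, s) is the binomial coefficient
    of -N over s. The proof is Pascal's rule in N and r. *)
Lemma signed_vandermonde N M r : (N <= M)%N ->
  \sum_(s < r.+1) (-1) ^+ s * 'C(N + s - 1, s)%:R * 'C(M, r - s)%:R
    = 'C(M - N, r)%:R :> rat.
Proof.
elim: N r => [|N IHN] r le_NM.
  rewrite big_ord_recl big1 ?addr0 => [|s _];
    first by rewrite bin0 !subn0 expr0 !mul1r.
  by rewrite bin_small ?mulr0 ?mul0r //= /bump; lia.
elim: r => [|r IHr].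
  by rewrite big_ord1 !bin0 expr0 !mul1r.
have := IHN r.+1 (ltnW le_NM).
have -> : (M - N = (M - N.+1).+1)%N by lia.
rewrite binS natrD -IHr => IH; apply: (addIr (\sum_(s < r.+1)
   (-1) ^+ s * 'C(N.+1 + s - 1, s)%:R * 'C(M, r - s)%:R)).
rewrite -IH big_ord_recl [in RHS]big_ord_recl -addrA; congr (_ + _).
  by rewrite !bin0.
rewrite -big_split; apply: eq_bigr => s _ /=.
rewrite /bump /= add1n subSS addSn addnS !subn1 /= binS natrD exprS; ring.
Qed.

(** The ballot numbers as differences of neighbouring binomials; this reduces the orthogonality to
    two Vandermonde sums. *)
Lemma ballot_bin M k :
  (M.+1%:R - 2 * k%:R) * 'C(M.+1, k)%:R
    = M.+1%:R * ('C(M, k)%:R - (if k is k'.+1 then 'C(M,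
      k') else 0%N)%:R) :> rat.
Proof.
case: k => [|k]; first by rewrite !bin0 mulr0 !subr0.
have eq1 : k.+1%:R * 'C(M.+1, k.+1)%:R = M.+1%:R * 'C(M, k)%:R :> rat.
  by rewrite -!natrM -mul_bin_diag.
rewrite binS natrD in eq1 *.
rewrite mulrBl -mulrA eq1; ring.
Qed.

Lemma chebyshev_orthogonality N t : (0 < N)%N ->
  \sum_(s < t.+1) (-1) ^+ s * (N + 2 * s)%:R * 'C(N + 2 * t, t - s)%:R
     * 'C(N + s - 1, s)%:R = (N * (t == 0))%N%:R :> rat.
Proof.
move=> N_gt0; case: t => [|t].
  by rewrite big_ord1 !muln0 !addn0 bin0 bin0 muln1 expr0 mul1r !mulr1.
pose M := (N + 2 * t).+1; have -> : (N + 2 * t.+1 = M.+1)%N by rewrite /M; lia.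
transitivity (M.+1%:R * (\sum_(s < t.+2) (-1) ^+ s * 'C(N + s - 1,
  s)%:R * 'C(M, t.+1 - s)%:R
    - \sum_(s < t.+1) (-1) ^+ s * 'C(N + s - 1, s)%:R * 'C(M, t - s)%:R) : rat).
  rewrite [X in _ = _ * (X - _)]big_ord_recr /= big_ord_recr /= subnn bin0.
  rewrite addrAC -sumrB mulrDr big_distrr /=; congr (_ + _).
    apply: eq_bigr => s _.
    have le_st : (s <= t)%N by rewrite -ltnS.
    rewrite subSn // -mulrBr [RHS]mulrC -[RHS]mulrA [X in _ = _ * X]mulrC.
    rewrite -(ballot_bin M (t - s).+1).
    have -> : (N + 2 * s)%:R = M.+1%:R - 2 * (t - s).+1%:R :> rat.
      apply: (addIr (2 * (t - s).+1%:R)); rewrite subrK -!natrM -natrD.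
      by congr (_%:R); rewrite /M; lia.
    by rewrite -!mulrA; congr (_ * _); rewrite mulrA mulrC.
  have -> : (N + 2 * t.+1 = M.+1)%N by rewrite /M; lia.
  by rewrite bin0 !mulr1 [RHS]mulrA [in RHS]mulrAC [in RHS]mulrC mulrA.
(* As M - N = 2t + 1, the two sums are C(2t+1, t+1) and C(2t+1, t), equal by symmetry. *)
rewrite !signed_vandermonde; try by rewrite /M; lia.
have -> : (M - N = (2 * t).+1)%N by rewrite /M; lia.
by rewrite -[in X in X - _]bin_sub;
  [rewrite (_ : _ - _ = t)%N ?subrr ?mulr0 ?muln0 //; lia|lia].
Qed.

Definition pruning_weight (mu l : nat) : rat :=
  if (mu < 2 * l)%N then (2 * l - mu)%N%:R / mu%:R * 'C(mu, l)%:R else 0.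

Definition monogon_weight (nu s : nat) : rat := (-1) ^+ s * 'C(nu - s - 1,
  s)%:R.

Lemma pruning_orthogonality mu r K : (0 < mu)%N -> (mu < K)%N -> (mu < 2 * r)%N
  ->
  \sum_(l < K) \sum_(s < K) pruning_weight mu l * monogon_weight (2 * l - mu) s
     * (r == l - s)%N%:R = (r == mu)%N%:R.
Proof.
move=> mu_gt0 lt_muK lt_mur; rewrite exchange_big /=.
pose h s := (2 * (r + s) - mu)%N%:R / mu%:R * 'C(mu, r + s)%:R
  * monogon_weight (2 * (r + s) - mu) s.
transitivity (\sum_(s < K) h s).
  (* Since r > 0, the truncated equation r = l - s forces l = r + s. When this leaves the range, mu
     < K <= r + s makes the binomial vanish. *)
  apply: eq_bigr => s _; have [lt_rsK|le_Krs] := ltnP (r + s) K.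
    rewrite (bigD1 (Ordinal lt_rsK)) //= addnK eqxx mulr1 big1 ?addr0.
      by rewrite /h /pruning_weight ifT //; lia.
    move=> l /eqP/val_eqP/= ne_l;
      rewrite (_ : (r == l - s)%N = false) ?mulr0 //.
    by apply/negbTE; apply: contra_neqN ne_l; lia.
  rewrite /h (bin_small (_ : mu < r + s)%N) ?mulr0 ?mul0r; last lia.
  rewrite big1 // => l _; rewrite (_ : (r == l - s)%N = false) ?mulr0 //.
  by have := ltn_ord l; lia.
have [lt_mr|le_rm] := ltnP mu r.
  rewrite (gtn_eqF lt_mr) big1 // => s _.
  by rewrite /h bin_small ?mulr0 ?mul0r //; lia.
(* With N = 2r - mu and t = mu - r one has N + 2t = mu and N + 2s = 2(r+s) - mu, which matches the
   two weights. *)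
have := @chebyshev_orthogonality (2 * r - mu) (mu - r).
rewrite subn_gt0 => /(_ lt_mur) cheb.
have mu_neq0 : mu%:R != 0 :> rat by rewrite Num.Theory.pnatr_eq0 -lt0n.
apply: (mulfI mu_neq0).
transitivity (((2 * r - mu) * (mu - r == 0))%N%:R : rat).
  rewrite -cheb.
  rewrite (big_ord_widen K (fun s => (-1) ^+ s * (2 * r - mu + 2 * s)%:R
    * 'C(2 * r - mu + 2 * (mu - r), mu - r - s)%:R * 'C(2 * r - mu + s - 1,
      s)%:R)); last by lia.
  rewrite big_distrr [LHS](bigID (fun s : 'I_K => (s < (mu - r).+1)%N)) /=.
  rewrite [X in _ + X]big1 ?addr0 => [|s lt_s]; last first.
    by rewrite /h bin_small ?mulr0 ?mul0r ?mulr0 //; lia.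
  apply: eq_bigr => s le_s; rewrite /h /monogon_weight.
  have -> : (2 * r - mu + 2 * (mu - r) = mu)%N by lia.
  have -> : (2 * r - mu + 2 * s = 2 * (r + s) - mu)%N by lia.
  have -> : (2 * r - mu + s - 1 = 2 * (r + s) - mu - s - 1)%N by lia.
  rewrite -(@bin_sub mu (r + s)) ?subnDA; last by lia.
  by field.
have [->|ne_rm] := eqVneq r mu.
  by rewrite subnn eqxx muln1 mulr1; congr (_%:R); lia.
by rewrite (_ : mu - r == 0 = false)%N ?muln0 ?mulr0 //; lia.
Qed.

Lemma pruning_inversion n (mu : 'I_n -> nat) K (f : {ffun 'I_n -> nat} -> rat) :
    (forall (rho : {ffun 'I_n -> nat}) i, rho i = 0%N -> f rho = 0) ->
    (forall i, 0 < mu i)%N -> (forall i, mu i < K)%N ->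
  \sum_(l : {ffun 'I_n -> 'I_K}) \prod_i pruning_weight (mu i) (l i)
     * (\sum_(s : {ffun 'I_n -> 'I_K}) \prod_i monogon_weight (2 * l i - mu i)
       (s i)
        * f [ffun i => 2 * l i - mu i - 2 * s i]%N)
    = f (finfun mu).
Proof.
move=> f0 mu_gt0 lt_mu.
(* The argument of f depends only on r = l - s: 2l - mu - 2s = 2(l - s) - mu holds for truncated
   subtraction too. Grouping by r makes the sum factor over i. *)
pose G i (r l s : 'I_K) := pruning_weight (mu i) l * monogon_weight (2 * l - mu
  i) s
  * (r == (l - s)%N :> nat)%:R.
transitivity (\sum_(r : {ffun 'I_n -> 'I_K})
    (\prod_i \sum_(l < K) \sum_(s < K) G i (r i) l s) * f [ffun i =>
      2 * r i - mu i]%N).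
  under [RHS]eq_bigr => r _.
    rewrite bigA_distr_bigA big_distrl /=.
    under eq_bigr do rewrite bigA_distr_bigA big_distrl /=.
    over.
  rewrite exchange_big /=; apply: eq_bigr => l _.
  rewrite exchange_big /= big_distrr /=; apply: eq_bigr => s _.
  have lt_sub i : (l i - s i < K)%N by apply: leq_ltn_trans (leq_subr _ _)
    (ltn_ord _).
  rewrite (bigD1 [ffun i => Ordinal (lt_sub i)]) //= [X in _ + X]big1 ?addr0.
    rewrite mulrA -big_split; congr (_ * f _).
      by apply: eq_bigr => i _; rewrite /G ffunE eqxx mulr1.
    by apply/ffunP => i; rewrite !ffunE /=; lia.
  move=> r ne_r; have /existsP[i ne_ri] : [exists i, r i != Ordinal (lt_sub i)].
    apply: contraR ne_r => /existsPn eq_r; apply/eqP/ffunP => i.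
    by rewrite ffunE; apply/eqP/negPn/eq_r.
  by rewrite (bigD1 i) //= /G (negbTE (ne_ri : (r i != l i - s i :> nat)%N))
    mulr0 !mul0r.
pose r0 := [ffun i => Ordinal (lt_mu i)].
rewrite (bigD1 r0) //= [X in _ + X]big1 ?addr0.
  rewrite big1 ?mul1r => [|i _].
    by congr f; apply/ffunP => i; rewrite !ffunE /=; lia.
  by rewrite pruning_orthogonality // ffunE ?eqxx //=; have := mu_gt0 i; lia.
move=> r ne_r; have [/forallP r_big|/forallPn[i r_small]] := boolP [forall i,
  mu i < 2 * r i]%N.
  have /existsP[i ne_ri] : [exists i, r i != r0 i].
    apply: contraR ne_r => /existsPn eq_r; apply/eqP/ffunP => i.
    by apply/eqP/negPn/eq_r.
  rewrite (bigD1 i) //= pruning_orthogonality //.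
  by move: ne_ri; rewrite ffunE -val_eqE /= => /negbTE ->; rewrite !mul0r.
(* If 2 r_i <= mu_i, the truncated argument of f is 0 at i, where f vanishes. *)
by rewrite (f0 _ i) ?mulr0 // ffunE; move: r_small; lia.
Qed.

End ChebyshevInversion.

(** * Bigons and edge lengths *)

Section EdgeWeights.
Variables (n g : nat) (nu : 'I_n -> nat).
Hypothesis stable : 2 < 2 * g + n.

(** Edge lengths are stored on half-edges. Only [eperm m] and [lab m] occur, so a map and its dual
    have the same weightings. *)
Definition edge_weighting (T : finType) (m : lmap T n) (c : T -> nat) :=
  [forall x, (0 < c x) && (c (eperm m x) == c x)]
  && [forall i, \sum_(x | lab m x == i) c x == nu i].

(** The bounded range makes the count finite; by [edge_weighting_le] no weighting is lost. *)
Definition num_weightings (T : finType) (m : lmap T n) :=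
  #|[set c : {ffun T -> 'I_(\sum_i nu i).+1} | edge_weighting m (fun x =>
    c x)]|.

Lemma edge_weighting_sum (T : finType) (m : lmap T n) c :
  edge_weighting m c -> \sum_x c x = \sum_i nu i.
Proof.
case/andP=> _ /forallP deg_c; rewrite (partition_big (lab m) predT) //=.
by apply: eq_bigr => i _; apply/eqP.
Qed.

Lemma edge_weighting_le (T : finType) (m : lmap T n) c x :
  edge_weighting m c -> c x <= \sum_i nu i.
Proof. by move/edge_weighting_sum <-; rewrite (bigD1 x) //= leq_addr. Qed.

Lemma num_weightings_relabel (T T' : finType) (h : T -> T') (k : T' -> T)
    (hK : cancel h k) (kK : cancel k h) (m : lmap T n) :
  num_weightings (relabel hK kK m) = num_weightings m.
Proof.
rewrite /num_weightings !card_set_sum.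
pose r (c : {ffun T -> 'I_(\sum_i nu i).+1}) := [ffun x' => c (k x')].
rewrite (reindex r); last first.
  exists (fun c' : {ffun T' -> _} => [ffun x => c' (h x)]) => c _;
    apply/ffunP => x; rewrite !ffunE.
    by rewrite hK.
  by rewrite kK.
apply: eq_bigr => c _; congr (nat_of_bool (_ && _)).
  rewrite (forall_transport kK); apply: eq_forallb => x.
  by rewrite eperm_relabel !ffunE !hK.
apply: eq_forallb => i; congr (_ == _).
rewrite (reindex h); last by exists k => x _; rewrite ?hK ?kK.
by apply: eq_big => x; rewrite ?lab_relabel // => _; rewrite ffunE hK.
Qed.

(* The two sides of the new bigon get lengths j and c b - j.                  *)
Definition split_weight (T : finType) (m : lmap T n) b (c : T -> nat) j x :=
  if x is Some (Some z) then c z - (z \in [:: b; eperm m b]) * j else j.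

(** The new half-edges lie at the vertices of b and [eperm m b], so the length j that each brings is
    exactly what the old one there loses. *)
Lemma edge_weighting_split (T : finType) (m : lmap T n) b c j :
    fixfree_involution (eperm m) -> (forall x, lab m (vperm m x) = lab m x) ->
  edge_weighting (add_bigon m b) (split_weight m b c j)
    = edge_weighting m c && (0 < j < c b).
Proof.
move=> inv lv; have eK := fixfreeK inv.
pose d z := (z \in [:: b; eperm m b]) : nat.
have dE z : d (eperm m z) = d z.
  by rewrite /d !inE (can2_eq eK eK) (can_eq eK) orbC.
have dS z : d z = (z == b) + (z == eperm m b).
  have /forallP/(_ b)/andP[/negbTE ne_b _] := inv.
  by rewrite /d !inE; case: (z =P b) => [->|]; rewrite // eq_sym ne_b.
have sum_pred1 (P : pred T) a : \sum_(z | P z) (z == a) = P a.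
  rewrite big_mkcond (bigD1 a) //= eqxx big1 ?addn0; first by case: (P a).
  by move=> z /negbTE ->; case: ifP.
have sumE i : (forall z, d z * j <= c z) ->
   \sum_(x | lab (add_bigon m b) x == i) split_weight m b c j x
     = \sum_(z | lab m z == i) c z.
  move=> le_c; rewrite [LHS]big_mkcond !big_option !ffunE /=.
  have -> : lab m ((vperm m)^-1 b)%g = lab m b.
    by rewrite -[in RHS](permKV (vperm m) b) lv.
  under eq_bigr do rewrite ffunE /=.
  rewrite -big_mkcond /=.
  rewrite -(subnK (_ : \sum_(z | lab m z == i) d z * j <= \sum_(z | lab m z ==
    i) c z)); last first.
    by apply: leq_sum => z _.
  rewrite -sumnB //= addnA addnC; congr (_ + _).
  under [RHS]eq_bigr do rewrite dS mulnDl.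
  rewrite big_split /= -!big_distrl /= !sum_pred1 addnC.
  by do 2!case: (lab m _ == i); rewrite ?mul1n ?mul0n.
have le_dj : (0 < j < c b) -> edge_weighting m c -> forall z, d z * j < c z.
  case/andP=> j_gt0 lt_j /andP[/forallP pos _] z; have /andP[z_gt0 _] := pos z.
  rewrite dS; have [->|] := eqVneq z b.
    by have /forallP/(_ b)/andP[/negbTE ne_b _] := inv;
      rewrite eq_sym ne_b addn0 mul1n.
  have [-> _|] := eqVneq z (eperm m b); last by rewrite mul0n.
  by have /andP[_ /eqP ->] := pos b; rewrite mul1n.
rewrite [LHS]/edge_weighting; apply/andP/andP =>
  [[/forallP pos' /forallP deg']|[wm jc]].
  have lt_dj z : d z * j < c z.
    by have /andP[] := pos' (Some (Some z)); rewrite /= subn_gt0.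
  split; last first.
    have /andP[-> _] := pos' None; have := lt_dj b.
    by rewrite /d !inE eqxx mul1n.
  apply/andP; split; apply/forallP => z; last first.
    by have := deg' z; rewrite sumE // => y; apply: ltnW.
  rewrite (leq_ltn_trans _ (lt_dj z)) //=.
  have /andP[_] := pos' (Some (Some z));
    rewrite add_pairE /= -/(d _) -/(d z) dE.
  by have := lt_dj z; have := lt_dj (eperm m z); rewrite dE; lia.
have lt_dj := le_dj jc wm; have /andP[j_gt0 lt_jc] := jc.
case/andP: wm => /forallP pos /forallP deg; split; apply/forallP => x.
  rewrite add_pairE; case: x => [[z|]|] /=; rewrite ?j_gt0 ?eqxx //.
  rewrite subn_gt0 lt_dj /= -/(d _) -/(d z) dE.
  by have /andP[_ /eqP ->] := pos z.
by rewrite sumE // => z; apply: ltnW.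
Qed.

(** Weightings of the new map correspond to pairs (c, j) with 0 < j < c b: [merge] adds the two
    lengths of the bigon, [split] undoes it. *)
Lemma num_weightings_add_bigon (T : finType) (m : lmap T n) b :
    fixfree_involution (eperm m) -> (forall x, lab m (vperm m x) = lab m x) ->
  num_weightings (add_bigon m b)
    = \sum_(c : {ffun T -> 'I_(\sum_i nu i).+1} | edge_weighting m (fun x =>
      c x))
        (c b).-1.
Proof.
move=> inv lv; set M := \sum_i nu i.
pose split (cj : {ffun T -> 'I_M.+1} * 'I_M.+1) : {ffun option (option T) ->
  'I_M.+1} :=
  [ffun x => inord (split_weight m b (fun z => cj.1 z) cj.2 x)].
pose merge (c' : {ffun option (option T) -> 'I_M.+1}) : {ffun T -> 'I_M.+1} *
  'I_M.+1 :=
  ([ffun z => inord (c' (Some (Some z)) + (z \in [:: b;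
    eperm m b]) * c' None)], c' None).
have splitE cj x : split cj x = split_weight m b (fun z =>
  cj.1 z) cj.2 x :> nat.
  rewrite ffunE inordK //; case: x => [[z|]|] //=.
  by apply: leq_ltn_trans (leq_subr _ _) (ltn_ord _).
have weightE cj : edge_weighting (add_bigon m b) (fun x => split cj x)
    = edge_weighting m (fun x => cj.1 x) && (0 < cj.2 < cj.1 b).
  rewrite -edge_weighting_split //; congr (_ && _).
    by apply: eq_forallb => x; rewrite !splitE.
  by apply: eq_forallb => i; under eq_bigr do rewrite splitE.
have mergeK (c' : {ffun option (option T) -> 'I_M.+1}) : edge_weighting
  (add_bigon m b) (fun x => c' x) -> split (merge c') = c'.
  move=> wc'; pose d z := c' (Some (Some z)) + (z \in [:: b;
    eperm m b]) * c' None.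
  have split_d x : split_weight m b d (c' None) x = c' x.
    case: x => [[z|]|] //=; first by rewrite addnK.
    by case/andP: wc' => /forallP/(_ None)/andP[_ /eqP]; rewrite add_pairE.
  have : edge_weighting (add_bigon m b) (split_weight m b d (c' None)).
    case/andP: wc' => /forallP pos /forallP deg; apply/andP; split;
      apply/forallP => y.
      by rewrite !split_d.
    by under eq_bigr do rewrite split_d.
  rewrite edge_weighting_split // => /andP[wd _].
  apply/ffunP => x; apply: val_inj; rewrite /= splitE -split_d /=.
  case: x => [[z|]|] //=.
  by rewrite ffunE inordK // ltnS; apply: (edge_weighting_le _ wd).
rewrite /num_weightings -sum1dep_card (reindex_onto split merge) //=.
transitivity (\sum_(cj : {ffun T -> 'I_M.+1} * 'I_M.+1
   | edge_weighting m (fun x => cj.1 x) && (0 < cj.2 < cj.1 b)) 1).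
  apply: eq_bigl => cj; rewrite weightE andb_idr // => /andP[wc jc].
  have := weightE cj; rewrite wc jc => ws.
  have ec : merge (split cj) = cj; last by rewrite ec.
  case: cj wc jc ws => c j wc jc ws; rewrite /merge; congr pair; last first.
    by apply: val_inj; rewrite /= splitE.
  apply/ffunP => z; rewrite ffunE; apply: val_inj; rewrite /= !splitE /= subnK.
    by rewrite inordK.
  have /andP[/forallP/(_ (Some (Some z)))/andP[pos _] _] := ws.
  by move: pos; rewrite splitE subn_gt0 => /ltnW.
rewrite -(pair_big_dep (fun c : {ffun T -> 'I_M.+1} =>
  edge_weighting m (fun x => c x))
   (fun c (j : 'I_M.+1) => 0 < j < c b) (fun _ _ => 1)) /=.
apply: eq_bigr => c wc; have cb_gt0 : 0 < c b by case/andP: wc =>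
  /forallP/(_ b)/andP[].
rewrite -(big_ord_widen_cond _ (fun j => 0 < j) (fun=> 1)); last exact: ltnW.
case: (c b : nat) cb_gt0 => // k _; rewrite big_mkcond big_ord_recl /=.
by rewrite sum1_card card_ord.
Qed.

Lemma sum_add_bigon (T : finType) (m : lmap T n) :
    fixfree_involution (eperm m) -> (forall x, lab m (vperm m x) = lab m x) ->
  \sum_b num_weightings (add_bigon m b) = (\sum_i nu i - #|T|) * num_weightings
    m.
Proof.
move=> inv lv; under eq_bigr do rewrite num_weightings_add_bigon //.
rewrite exchange_big /= /num_weightings -sum1dep_card big_distrr /=.
apply: eq_bigr => c wc;
  rewrite muln1 -[X in _ = X - _](edge_weighting_sum wc) -sum1_card.
under eq_bigr do rewrite -subn1; rewrite sumnB // => x _.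
by case/andP: wc => /forallP/(_ x)/andP[].
Qed.

Section BigonFaces.
Variables (T : finType) (m : lmap T n) (b : T).
Hypothesis inv : fixfree_involution (eperm m).
Let t := tperm None (Some b).
Let f' := fperm (add_bigon m b).

Lemma fperm_add_bigon_None : f' None = Some (Some b).
Proof.
rewrite /f' fperm_add_bigon // ins_after_None; congr Some.
have := permJ (perm_option (fperm m)) (tperm None (Some b)) None.
by rewrite tpermL perm_optionE tpermL.
Qed.

Lemma fperm_add_bigon_old : f' (Some (Some b)) = None.
Proof. by rewrite /f' fperm_add_bigon // ins_after_Some eqxx. Qed.

Lemma fperm_add_bigon_Some z : f' (Some (t (Some z))) = Some (t (Some (fperm m
  z))).
Proof.
rewrite /f' fperm_add_bigon // ins_after_Some -[X in _ == X](tpermL None (Some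
  b)).
by rewrite (inj_eq perm_inj) /= permJ perm_optionE.
Qed.

Lemma on_bigon_add_bigon_None : on_bigon (add_bigon m b) None.
Proof. by rewrite /on_bigon !(fperm_add_bigon_None, fperm_add_bigon_old). Qed.

Lemma on_bigon_add_bigon_Some z :
  on_bigon (add_bigon m b) (Some (t (Some z))) = on_bigon m z.
Proof.
by rewrite /on_bigon !fperm_add_bigon_Some !(inj_eq Some_inj) !(inj_eq
  perm_inj).
Qed.

Lemma bigon_sides_add_bigon : bigon_sides (add_bigon m b) = (bigon_sides m).+2.
Proof.
rewrite /bigon_sides !card_set_sum big_option on_bigon_add_bigon_None.
rewrite (reindex_inj (@perm_inj _ t)) /= big_option tpermL.
rewrite (_ : on_bigon _ (Some (Some b))) /=; last first.
  by rewrite /on_bigon !(fperm_add_bigon_None, fperm_add_bigon_old) eqxx.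
by under eq_bigr do rewrite on_bigon_add_bigon_Some.
Qed.

Lemma no_monogon_add_bigon : no_monogon (add_bigon m b) = no_monogon m.
Proof.
apply/forallP/forallP => [nomono z|nomono [y|]].
- have := nomono (Some (t (Some z))).
  by rewrite fperm_add_bigon_Some !(inj_eq Some_inj, inj_eq perm_inj).
- rewrite -(permKV t y); case: ((t^-1)%g y) => [z|].
    by rewrite fperm_add_bigon_Some !(inj_eq Some_inj, inj_eq perm_inj) nomono.
  by rewrite tpermL fperm_add_bigon_old.
- by rewrite fperm_add_bigon_None.
Qed.

End BigonFaces.

Definition bigon_sum (T : finType) k :=
  \sum_(m : lmap T n | [&& labelled_map g m, no_monogon m & bigon_sides m == k])
    num_weightings m.

Lemma bigon_sum_transport (T T' : finType) k : #|T| = #|T'| ->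
  bigon_sum T k = bigon_sum T' k.
Proof.
case/card_transport => h [h' [hK kK]]; rewrite /bigon_sum.
rewrite [RHS](sum_relabel _ hK kK); apply: eq_big => m.
  by rewrite labelled_map_relabel no_monogon_relabel bigon_sides_relabel.
by rewrite num_weightings_relabel.
Qed.

(** The factor k chooses a marked bigon side. Removing its bigon costs two sides, and
    [sum_add_bigon] counts the ways to put it back. *)
Lemma bigon_sum_rec (T : finType) k :
  k * bigon_sum (option (option T)) k
    = #|T|.+2 * #|T|.+1
        * ((\sum_i nu i - #|T|) * (if k is k'.+2 then bigon_sum T k' else 0)).
Proof.
pose F (m : lmap (option (option T)) n) x :=
  if [&& labelled_map g m, no_monogon m, bigon_sides m == k & on_bigon m x]
  then num_weightings m else 0.
transitivity (\sum_m \sum_x F m x).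
  rewrite /bigon_sum big_distrr /= big_mkcond; apply: eq_bigr => m _.
  rewrite /F; case: (labelled_map g m); last by rewrite /= big1.
  case: (no_monogon m); last by rewrite /= big1.
  case: eqP => /= [<-|_]; last by rewrite big1.
  by rewrite -big_mkcond sum_nat_const -cardsE.
rewrite sum_marked; last 2 first.
- move=> f m x; rewrite /F labelled_map_relabel no_monogon_relabel.
  by rewrite bigon_sides_relabel on_bigon_relabel num_weightings_relabel.
- move=> m x ex; rewrite /F labelled_mapE.
  by case: ifP => // /andP[/andP[/forallP/(_ x)]]; rewrite ex eqxx.
congr (_ * _); rewrite /F -big_mkcondr /=.
rewrite (big_reindex_surj _ _ (@add_bigon_inj T n)); last first.
  move=> m' /andP[/eqP eN /and4P[lm _ _ onN]].
  by have [m [b ->]] := add_bigon_surj stable lm eN onN; exists (m, b).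
have labelledP (m : lmap T n) : labelled_map g m ->
    fixfree_involution (eperm m) /\ forall x, lab m (vperm m x) = lab m x.
  rewrite labelled_mapE => /and4P[inv _ /forallP lv _].
  by split=> // x; apply/eqP.
transitivity (\sum_(mb : lmap T n * T
    | [&& labelled_map g mb.1,
      no_monogon mb.1 & (bigon_sides mb.1).+2 == k] && true)
    num_weightings (add_bigon mb.1 mb.2)).
  apply: eq_bigl => -[m b] /=;
    rewrite labelled_add_bigon add_pairE eqxx /= andbT.
  have [/labelledP[inv _]|] //= := boolP (labelled_map g m).
  by rewrite no_monogon_add_bigon // bigon_sides_add_bigon //
    on_bigon_add_bigon_None // andbT.
rewrite -(pair_big_dep (fun m => [&& labelled_map g m,
  no_monogon m & (bigon_sides m).+2 == k])
  (fun _ _ => true) (fun m b => num_weightings (add_bigon m b))) /=.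
case: k {F} => [|[|k]]; try by rewrite muln0 big_pred0 // => m; rewrite !andbF.
rewrite /bigon_sum big_distrr; apply: eq_bigr =>
  m /and3P[/labelledP[inv lv] _ _].
exact: sum_add_bigon.
Qed.

End EdgeWeights.

(** * Solution of the bigon recursion *)

Section BigonCount.
Variables (n g : nat) (nu : 'I_n -> nat).
Hypothesis stable : 2 < 2 * g + n.
Let M := \sum_i nu i.
Local Open Scope ring_scope.

(** Euler's relation reads |T| = 2(n + F + 2g) - 4, where n + 2g > 2. *)
Lemma labelled_map_parity (T : finType) (m : lmap T n) : labelled_map g m ->
  ~~ odd #|T| /\ (1 < #|T|)%N.
Proof.
rewrite labelled_mapE => /and5P[_ _ _ _ /andP[_ /eqP]].
by move: #|porbits _| #|T| stable => a b; lia.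
Qed.

Lemma bigon_sum_eq0 (T : finType) k :
  odd #|T| || (#|T| <= 1)%N || (M < #|T|)%N -> bigon_sum g nu T k = 0%N.
Proof.
move=> T_bad; rewrite /bigon_sum big1 // =>
  m /andP[/labelled_map_parity[T_even T_gt1] _].
move: T_bad; rewrite (negbTE T_even) leqNgt T_gt1 /= => lt_MT.
apply: eq_card0 => c; rewrite inE; apply/negP => wc.
have := edge_weighting_sum wc; rewrite -/M => sum_c.
suff : (#|T| <= M)%N by rewrite leqNgt lt_MT.
rewrite -sum_c -sum1_card; apply: leq_sum => x _.
by case/andP: wc => /forallP/(_ x)/andP[].
Qed.

Definition bigon_moment N k : rat := (bigon_sum g nu 'I_N k)%:R / N`!%:R.

Lemma bigon_moment_rec N k : k%:R * bigon_moment N.+2 k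
  = (M - N)%N%:R * (if k is k'.+2 then bigon_moment N k' else 0).
Proof.
rewrite /bigon_moment (@bigon_sum_transport _ _ _ _ (option (option 'I_N)))
  ?card_option ?card_ord //.
rewrite mulrA -natrM bigon_sum_rec // card_ord !factS !natrM -/M.
have neq0 i : (0 < i)%N -> i%:R != 0 :> rat by rewrite Num.Theory.pnatr_eq0
  -lt0n.
case: k => [|[|k]]; rewrite ?mul0r ?mulr0 ?mul0r //.
by field; rewrite nat1r -natrD !neq0 ?fact_gt0.
Qed.

Lemma bigon_moment_eq0 N k : odd N || (N <= 1)%N || (M < N)%N -> bigon_moment N
  k = 0.
Proof. by move=> N_bad;
  rewrite /bigon_moment bigon_sum_eq0 ?card_ord ?mul0r. Qed.

Lemma bigon_moment_odd N k : odd k -> bigon_moment N k = 0.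
Proof.
have [j le_kj] := ubnP k; elim: j => // j IH in N k le_kj *.
case: N => [|[|N]] k_odd; try by rewrite bigon_moment_eq0.
have k_neq0 : k%:R != 0 :> rat by rewrite Num.Theory.pnatr_eq0;
  case: k k_odd {le_kj}.
apply: (mulfI k_neq0); rewrite mulr0 bigon_moment_rec.
case: k le_kj k_odd {k_neq0} => [|[|k]] //=; rewrite ?mulr0 // negbK =>
  le_kj k_odd.
by rewrite IH ?mulr0 //; lia.
Qed.

Lemma bigon_moment_odd_sub N k : (N <= M)%N -> odd (M - N) -> bigon_moment N k
  = 0.
Proof.
(* The recursion is read upwards: N grows by 2 at fixed parity of M - N, with nonzero factor M - N,
   until N exceeds M and the count is 0. *)
have [j lt_j] := ubnP (M - N)%N; elim: j => // j IH in N k lt_j *.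
move=> le_NM odd_MN.
have neq0 : (M - N)%N%:R != 0 :> rat by rewrite Num.Theory.pnatr_eq0;
  case: (M - N)%N odd_MN.
apply: (mulfI neq0); rewrite mulr0 -(bigon_moment_rec N k.+2).
have [lt_MN|le_NM2] := ltnP M N.+2.
  by rewrite bigon_moment_eq0 ?mulr0 // lt_MN !orbT.
by rewrite IH ?mulr0 //; lia.
Qed.

(** Each step multiplies by (M - N - 2i)/(2i + 2) = (j - i)/(i + 1), the ratio of consecutive
    binomials. *)
Lemma bigon_moment_binomial N j i : M = (N + 2 * j)%N -> (i <= j)%N ->
  bigon_moment (N + 2 * i) (2 * i) = 'C(j, i)%:R * bigon_moment N 0.
Proof.
move=> def_M; elim: i => [|i IH] lt_ij; first by rewrite muln0 addn0 bin0 mul1r.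
have neq0 : i.+1%:R != 0 :> rat by rewrite Num.Theory.pnatr_eq0.
have neq2 : 2 != 0 :> rat by [].
apply: (mulfI neq0); apply: (mulfI neq2).
have -> : (N + 2 * i.+1 = (N + 2 * i).+2)%N by lia.
rewrite mulrA -natrM bigon_moment_rec.
have -> : (2 * i.+1 = (2 * i).+2)%N by lia.
rewrite IH 1?ltnW //; move: (bigon_moment N 0) => c.
rewrite !mulrA -!natrM; congr (_%:R * c).
rewrite -[RHS]mulnA mul_bin_left mulnA; congr (_ * _)%N; lia.
Qed.

(** The case i = j of the binomial formula; when M - N is odd both sides are 0. *)
Lemma bigon_moment_diag N : (N <= M)%N -> bigon_moment M (M - N)%N =
  bigon_moment N 0.
Proof.
move=> le_NM; have [odd_MN|even_MN] := boolP (odd (M - N)).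
  by rewrite bigon_moment_odd // bigon_moment_odd_sub.
pose j := (M - N)./2; have def_M : M = (N + 2 * j)%N by rewrite /j; lia.
have := bigon_moment_binomial def_M (leqnn j); rewrite -def_M binn mul1r => <-.
by congr bigon_moment; lia.
Qed.

(** M positive lengths with sum M are all 1, and the weighting condition then just prescribes the
    vertex degrees. *)
Lemma num_weightings_unit (m : lmap 'I_M n) :
  (0 < M)%N -> num_weightings nu m = (vdeg m == finfun nu).
Proof.
move=> M_gt0; rewrite /num_weightings.
pose one : {ffun 'I_M -> 'I_M.+1} := [ffun=> Ordinal (M_gt0 : (1 < M.+1)%N)].
have weight_one : edge_weighting nu m (fun x => one x) = (vdeg m == finfun nu).
  apply/andP/eqP => [[_ /forallP deg]|deg].
    by apply/ffunP => i; rewrite !ffunE -(eqP (deg i)) -sum1dep_card;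
      apply: eq_bigr => x _; rewrite ffunE.
  split; apply/forallP => x; first by rewrite !ffunE eqxx.
  have /ffunP/(_ x) := deg; rewrite !ffunE -sum1dep_card => <-.
  by apply/eqP/eq_bigr => y _; rewrite ffunE.
rewrite -weight_one card_set_sum (bigD1 one) //= [X in (_ + X)%N]big1 ?addn0 //
  => c ne_c1.
apply/eqP; rewrite eqb0; apply: contra ne_c1 => wc; apply/eqP/ffunP => x.
have pos y : (0 < c y)%N by case/andP: wc => /forallP/(_ y)/andP[].
have sum0 : (\sum_y (c y - 1) = 0)%N.
  by rewrite sumnB // (edge_weighting_sum wc) sum1_card card_ord subnn.
apply: val_inj; rewrite ffunE /=; have := pos x.
by move/eqP: sum0; rewrite sum_nat_eq0 => /forallP/(_ x)/=; lia.
Qed.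

(** Maps on M half-edges are sorted by their number k of bigon sides; k = M - N is then traded for
    bigon-free maps on N half-edges. *)
Lemma monogon_free_count_bigon :
  monogon_free_count g (finfun nu) = \sum_(N < M.+1) bigon_moment N 0.
Proof.
have eM : (\sum_i (finfun nu) i = M)%N by apply: eq_bigr => i _; rewrite ffunE.
transitivity (\sum_(k < M.+1) bigon_moment M k); last first.
  rewrite (reindex_inj rev_ord_inj) /=; apply: eq_bigr => N _.
  by rewrite subSS bigon_moment_diag // -ltnS.
rewrite /monogon_free_count eM /bigon_moment -mulr_suml -natr_sum.
congr (_%:R / _); rewrite /bigon_sum -sum1dep_card.
have sides_le (m : lmap 'I_M n) : (bigon_sides m < M.+1)%N.
  by rewrite ltnS -[X in (_ <= X)%N]card_ord max_card.
rewrite (eq_bigr (fun k : 'I_M.+1 => \sum_(m : lmap 'I_M n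
    | (labelled_map g m && no_monogon m) && (inord (bigon_sides m) == k))
      num_weightings nu m)%N) => [|k _]; last first.
  apply: eq_bigl => m; rewrite -andbA; congr [&& _, _ & _].
  by rewrite -val_eqE /= inordK.
rewrite -(partition_big (fun m : lmap 'I_M n =>
  inord (bigon_sides m)) predT) //=.
rewrite big_mkcond [RHS]big_mkcond; apply: eq_bigr => m _.
have [lm|] //= := boolP (labelled_map g m).
have M_gt0 : (0 < M)%N by have [_] := labelled_map_parity lm; rewrite card_ord;
  apply: ltnW.
rewrite num_weightings_unit // andbC.
by case: (no_monogon m) => //=; case: (vdeg m == _).
Qed.

Lemma bigon_moment_even B : (forall e,
  (B < e)%N -> bigon_moment (2 * e) 0 = 0) ->
  \sum_(N < M.+1) bigon_moment N 0 = \sum_(e < B.+1) bigon_moment (2 * e) 0.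
Proof.
move=> large_e; have sum_even L : \sum_(N < 2 * L) bigon_moment N 0
    = \sum_(e < L) bigon_moment (2 * e) 0.
  elim: L => [|L IH]; first by rewrite muln0 !big_ord0.
  have -> : (2 * L.+1 = (2 * L).+2)%N by lia.
  rewrite !big_ord_recr /= IH -addrA; congr (_ + _).
  by rewrite [X in _ + X]bigon_moment_eq0 ?addr0 //; lia.
pose L := (B + M).+1; transitivity (\sum_(N < 2 * L) bigon_moment N 0).
  rewrite (big_ord_widen (2 * L) (fun N => bigon_moment N 0));
    last by rewrite /L; lia.
  rewrite big_mkcond; apply: eq_bigr => N _; case: ltnP => // lt_MN.
  by rewrite bigon_moment_eq0 // lt_MN !orbT.
rewrite sum_even [RHS](big_ord_widen L (fun e => bigon_moment (2 * e) 0));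
  last by rewrite /L; lia.
rewrite [RHS]big_mkcond; apply: eq_bigr => e _; case: ltnP => // lt_Be.
by rewrite large_e.
Qed.

End BigonCount.

(** * Duality with ribbon graphs *)

Section DualMap.
Variables (T : finType) (n : nat).
Implicit Types m : lmap T n.

Definition dual m : lmap T n := LMap (fperm m) (eperm m) (lab m).

(** An injective self-map of a finite type is bijective, which allows sums over maps to be reindexed
    by [dual]. *)
Lemma dual_inj : injective dual.
Proof.
move=> [v1 e1 l1] [v2 e2 l2] [].
by rewrite /fperm /= => ev ee ->; move: ev; rewrite ee => /mulgI ->.
Qed.

Lemma fperm_dual m : fixfree_involution (eperm m) -> fperm (dual m) = vperm m.
Proof. by move=> /fixfreeK eK; apply/permP => x; rewrite !permM /= eK. Qed.

Lemma connected_dual m : fixfree_involution (eperm m) ->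
  connected_map (dual m) = connected_map m.
Proof.
move=> inv; rewrite /connected_map.
(* Stated for two maps so that it applies in both directions: each of [vperm m] and [fperm m] is the
   other preceded by [eperm m]. *)
have sub m1 m2 : eperm m1 = eperm m2 -> (forall x,
  vperm m1 x = vperm m2 (eperm m2 x)) ->
  [forall x, forall y, connect [rel u v | (v == vperm m1 u) || (v == eperm m1
    u)] x y] ->
  [forall x, forall y, connect [rel u v | (v == vperm m2 u) || (v == eperm m2
    u)] x y].
  move=> ee ev /forallP conn; apply/forallP => x; apply/forallP => y.
  apply: connect_sub (forallP (conn x) y) => {x y} x y /=.
  case/orP => /eqP ->; last by rewrite ee; apply: connect1;
    rewrite /= eqxx orbT.
  rewrite ev; apply: connect_trans (_ : connect _ _ (eperm m2 x)) _.
    by apply: connect1; rewrite /= eqxx orbT.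
  by apply: connect1; rewrite /= eqxx.
apply/idP/idP; apply: sub => // x; first by rewrite /= permM.
by rewrite /= permM fixfreeK.
Qed.

Lemma card_porbit_ge3 (s : {perm T}) x :
  (3 <= #|porbit s x|) = (s x != x) && (s (s x) != x).
Proof.
have := iter_porbit s x; have := uniq_traject_porbit s x.
have : 0 < #|porbit s x| by rewrite lt0n card_porbit_neq0.
case: #|porbit s x| => [|[|[|k]]] //= _ uniq_s.
- by move=> ->; rewrite eqxx.
- by move=> ->; rewrite eqxx andbF.
move=> _; move: uniq_s; rewrite !inE !negb_or eq_sym =>
  /andP[/and3P[-> ne _] _].
by rewrite eq_sym ne.
Qed.

(** Vertices of m are faces of [dual m], so degree at least 3 excludes exactly faces of length 1 and
    2. *)
Lemma ribbon_graphE g m : ribbon_graph g m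
  = [&& labelled_map g (dual m),
    no_monogon (dual m) & bigon_sides (dual m) == 0].
Proof.
rewrite /ribbon_graph /labelled_map /embedded_graph /=.
have [inv|] //= := boolP (fixfree_involution (eperm m)).
rewrite connected_dual // /has_genus fperm_dual // [#|porbits (vperm (dual
  m))|]/=.
rewrite [#|porbits (fperm m)| + _]addnC -!andbA; congr [&& _, _, _, _ & _].
apply/forallP/andP => [deg3|[/forallP nomono /eqP/card0_eq nobi] x].
  split.
    apply/forallP => x; rewrite fperm_dual //.
    by have := deg3 x; rewrite card_porbit_ge3 => /andP[].
  apply/eqP/eq_card0 => x; rewrite inE /on_bigon fperm_dual //.
  by have := deg3 x; rewrite card_porbit_ge3 => /andP[_ /negbTE ->];
    rewrite andbF.
rewrite card_porbit_ge3; have := nomono x; rewrite fperm_dual // => fx.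
by have := nobi x; rewrite inE /on_bigon fperm_dual // fx /= => ->.
Qed.

End DualMap.

(** * Solutions of the incidence system as edge weightings *)

Section EdgeIndex.
Variables (T : finType) (n : nat) (m : lmap T n).

Lemma mem_edges x : porbit (eperm m) x \in edges m.
Proof. exact: imset_f. Qed.

Definition edge_index x : 'I_#|edges m| :=
  enum_rank_in (mem_edges x) (porbit (eperm m) x).

Lemma edge_indexK x : enum_val (edge_index x) = porbit (eperm m) x.
Proof. exact: enum_rankK_in (mem_edges x). Qed.

Lemma edge_index_eq x k : (edge_index x == k) = (x \in (enum_val k : {set T})).
Proof.
have /imsetP[y _ def_k] := enum_valP k.
rewrite def_k -eq_porbit_mem -(edge_indexK x) -def_k.
by rewrite (inj_eq (@enum_val_inj _ _)).
Qed.

Lemma edge_index_surj k : exists x, edge_index x = k.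
Proof.
have /imsetP[y _ def_k] := enum_valP k.
by exists y; apply/eqP; rewrite edge_index_eq def_k porbit_id.
Qed.

Lemma edge_index_eperm x : edge_index (eperm m x) = edge_index x.
Proof. by apply: enum_val_inj; rewrite !edge_indexK (porbit_perm _ 1). Qed.

(** A vector indexed by edges is a function on half-edges constant on the cycles of [eperm m]. The
    entry of the incidence matrix counts the halves of an edge with a given label. *)
Lemma num_solutionsE (mu : 'I_n -> nat) : num_solutions mu m = num_weightings
  mu m.
Proof.
rewrite /num_solutions /num_weightings; set M := \sum_i mu i.
pose w (x : 'cV['I_M.+1]_#|edges m|) : {ffun T -> 'I_M.+1} :=
  [ffun h => x (edge_index h) 0%R].
have w_inj : injective w.
  move=> x y /ffunP eq_w; apply/colP => k; have [h <-] := edge_index_surj k.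
  by have := eq_w h; rewrite !ffunE.
have incE (x : 'cV['I_M.+1]_#|edges m|) i :
    (incidence_mx m *m map_mx (@nat_of_ord _) x)%R i 0%R = \sum_(h | lab m h ==
      i) w x h.
  rewrite mxE (partition_big edge_index predT) //=; apply: eq_bigr => k _.
  rewrite !mxE -sum1dep_card big_distrl /=; apply: eq_big => [h|h /andP[hk _]].
    by rewrite andbC edge_index_eq.
  rewrite mul1r ffunE; congr (nat_of_ord (x _ _)).
  by apply/esym/eqP; rewrite edge_index_eq.
rewrite -(card_imset _ w_inj); apply: eq_card => c; rewrite !inE.
apply/imsetP/andP => [[x]|[/forallP pos /forallP deg]].
  rewrite inE => /andP[/forallP pos /eqP sol] ->; split; apply/forallP => i.
    by rewrite !ffunE edge_index_eperm pos eqxx.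
  by rewrite -incE sol mxE.
have c_porbit h y : y \in porbit (eperm m) h -> c y = c h.
  case/porbitP => j ->; elim: j => [|j IH]; first by rewrite expg0 perm1.
  rewrite expgSr permM -IH; apply: val_inj.
  by have /andP[_ /eqP] := pos ((eperm m ^+ j)%g h).
have index_surj k : exists h, edge_index h == k.
  by have [h <-] := edge_index_surj k; exists h.
pose x : 'cV['I_M.+1]_#|edges m| := (\col_k c (xchoose (index_surj k)))%R.
have wx : c = w x.
  apply/ffunP => h; rewrite ffunE mxE; apply: c_porbit.
  have := xchooseP (index_surj (edge_index h)).
  by rewrite edge_index_eq edge_indexK porbit_sym.
exists x => //; rewrite inE; apply/andP; split.
  apply/forallP => k; have [h <-] := edge_index_surj k.
  by have := congr1 (fun c : {ffun T -> 'I_M.+1} => c h) wx; rewrite ffunE =>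
    <-; have /andP[] := pos h.
apply/eqP/colP => i; rewrite incE mxE -(eqP (deg i)).
by apply: eq_bigr => h _; rewrite -wx.
Qed.

End EdgeIndex.

(** * Identification of D and N with the map counts *)

Section Comparison.
Variables (n g : nat).
Hypothesis stable : 2 < 2 * g + n.

Lemma dual_relabel (T : finType) (f : {perm T}) (m : lmap T n) :
  dual (relabel_by f m) = relabel_by f (dual m).
Proof. by congr LMap; rewrite fperm_relabelE. Qed.

Lemma Ngn_bigon_moment (nu : 'I_n -> nat) :
  Ngn g nu = (\sum_(e < (6 * g + 3 * n - 6).+1) bigon_moment g nu (2 * e) 0)%R.
Proof.
apply: eq_bigr => e _; rewrite iso_class_sumE.
- rewrite card_ord /bigon_moment /bigon_sum natr_sum; congr (_ / _)%R.
  rewrite [RHS](reindex_inj (@dual_inj _ n)); apply: eq_big => m.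
    exact: ribbon_graphE.
  by rewrite num_solutionsE.
- move=> f m; rewrite !ribbon_graphE dual_relabel labelled_map_relabel.
  by rewrite no_monogon_relabel bigon_sides_relabel.
- by move=> f m; rewrite !num_solutionsE num_weightings_relabel.
Qed.

Lemma Ngn_monogon_free_count (nu : 'I_n -> nat) :
  Ngn g nu = monogon_free_count g (finfun nu).
Proof.
rewrite Ngn_bigon_moment monogon_free_count_bigon //.
(* Beyond the bound on the number of edges there are no ribbon graphs, so the two truncations of the
   sum agree. *)
apply/esym/bigon_moment_even => // e lt_e.
rewrite /bigon_moment /bigon_sum (reindex_inj (@dual_inj _ n)) big_pred0 ?mul0r
  // => m.
rewrite -ribbon_graphE; apply/negP => /ribbon_graph_edges_le.
by rewrite leqNgt lt_e.
Qed.

Lemma Dgn_map_count (mu : 'I_n -> nat) : Dgn g mu = map_count g (finfun mu).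
Proof.
rewrite /map_count /monogon_moment.
have -> : \sum_i (finfun mu) i = \sum_i mu i by apply: eq_bigr => i _;
  rewrite ffunE.
have vlgE (m : lmap 'I_(\sum_i mu i) n) : vertex_labelled_graph g mu m
    = labelled_map g m && (vdeg m == finfun mu).
  rewrite /vertex_labelled_graph andbA; congr (_ && _).
  apply/forallP/eqP => [deg|/ffunP deg i].
    by apply/ffunP => i; rewrite !ffunE; apply/eqP.
  by have := deg i; rewrite !ffunE => ->.
rewrite /Dgn iso_class_sumE // => [|f m]; last first.
  by rewrite !vlgE labelled_map_relabel vdeg_relabel.
rewrite card_ord /monogon_sum natr_sum; congr (_ / _)%R.
apply: eq_big => // m _; rewrite big1 // => i _.
by rewrite ffunE bin0.
Qed.

End Comparison.

(* The sum over l is truncated to l i <= max_j mu j: 'C(mu i, l i) vanishes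
   for l i > mu i. *)
Theorem corollary1p3 (g n : nat) (mu : 'I_n -> nat) :
  1 <= n -> 2 < 2 * g + n -> (forall i, 0 < mu i) ->
  (Dgn g mu =
   \sum_(l : {ffun 'I_n -> 'I_(\max_j mu j).+1} |
           [forall i, (mu i < 2 * l i)%N])
     (\prod_(i < n) (((2 * l i - mu i)%N)%:R / (mu i)%:R
                      * 'C(mu i, l i)%:R))
     * Ngn g (fun i => (2 * l i - mu i)%N))%R.
Proof.
move=> _ stable mu_gt0; set K := (\max_j mu j).+1.
have lt_mu i : mu i < K by rewrite ltnS leq_bigmax.
rewrite Dgn_map_count.
rewrite -(pruning_inversion (map_count_eq0 g (n := n)) mu_gt0 lt_mu).
rewrite [RHS]big_mkcond; apply: eq_bigr => l _.
case: forallP => [big_l|/forallP/forallPn[i small_l]]; last first.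
  by rewrite (bigD1 i) //= /pruning_weight (negbTE small_l) !mul0r.
rewrite (eq_bigr (fun i =>
    (2 * l i - mu i)%N%:R / (mu i)%:R * 'C(mu i, l i)%:R)%R) => [|i _]; last first.
  by rewrite /pruning_weight big_l.
(* If some l_i > mu_i, the binomial kills both terms. Otherwise 2 l_i - mu_i <= mu_i < K, which the
   sieve with bound K requires. *)
have [/forallP le_l|/forallPn[i gt_l]] := boolP [forall i, l i <= mu i];
  last first.
  by rewrite (bigD1 i) //= bin_small ?mulr0 ?mul0r // ltnNge.
congr (_ * _)%R; rewrite Ngn_monogon_free_count // (@monogon_free_countE _ _
  stable _ K) => [|i]; last first.
  rewrite ffunE (leq_ltn_trans _ (lt_mu i)) // leq_subLR mul2n -addnn.
  by rewrite leq_add ?le_l.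
apply: eq_bigr => s _; congr (_ * _)%R.
  by apply: eq_bigr => i _; rewrite ffunE.
by congr map_count; apply/ffunP => i; rewrite !ffunE.
Qed.
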